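(* Let $S$ be a complete semiring, $(\mathbf{C},\otimes,I)$ a small strict monoidal category, $\mathcal{F}$ a system of fields and $\mathbb{T}$ a system of $\mathbf{C}$-valued action exponentials. Let $M$ and $N$ be closed $n$-manifolds and let $\pi_{M,N}:Z(M\sqcup N)\to Z(M\sqcup N)$ be the map $\pi_{M,N}(z)=\langle Z_{M\times[0,1]},z\rangle$, where $M\times[0,1]$ is viewed as a bordism from $M=M\times\{0\}$ to $M=M\times\{1\}$. (1) The state sum $Z_W$ of any bordism $W$ from $M$ to $N$ is in the image of $\pi_{M,N}$. In fact $Z_W=\pi_{M,N}(Z_W)$, i.e. $\pi_{M,N}$ acts as the identity on the set of all state sums. (2) The map $\pi_{M,N}$ is a projection, that is, $\pi_{M,N}^2=\pi_{M,N}$.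
   Context: A semiring $(S,+,\cdot,0,1)$ consists of a commutative monoid $(S,+,0)$ and a (not necessarily commutative) monoid $(S,\cdot,1)$ such that $\cdot$ distributes over $+$ from both sides and $0$ is absorbing. A complete monoid is a commutative monoid $(M,+,0)$ with a summation law assigning to every family $(m_i)_{i\in I}$, $I$ an arbitrary set, an element $\sum_{i\in I}m_i$ such that $\sum_{i\in\varnothing}m_i=0$, $\sum_{i\in\{1\}}m_i=m_1$, $\sum_{i\in\{1,2\}}m_i=m_1+m_2$, and $\sum_{j\in J}\big(\sum_{i\in I_j}m_i\big)=\sum_{i\in I}m_i$ for every partition $I=\bigcup_{j\in J}I_j$. A semiring is complete if $(S,+,0,\sum)$ is a complete monoid and $\sum_i ss_i=s\sum_i s_i$, $\sum_i s_is=(\sum_i s_i)s$. $Q=Q_S(\mathbf{C})$ is the complete monoid of functions $\operatorname{Mor}(\mathbf{C})\to S$ with pointwise addition and summation. The composition semiring is $Q^c=(Q,+,\cdot,0,1)$ with $(a\cdot b)(\gamma)=\sum_{\beta\circ\alpha=\gamma}b(\beta)a(\alpha)$ and $1$ the characteristic function of the set of identity morphisms; it is a complete semiring. Fix an integer $n\ge 0$. Manifolds are topological and need not be orientable; $\varnothing$ is a manifold of every dimension; $\sqcup$ is the ordered disjoint union. A bordism from $M$ to $N$ is a triple $(W,M,N)$ (often abbreviated $W$) with $W$ a compact $(n+1)$-dimensional topological manifold, $\partial W=M\sqcup N$, where the closed $n$-manifolds $M,N$ are the incoming and outgoing boundary. $(W,M,N)\sqcup(W',M',N')=(W\sqcup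 W',M\sqcup M',N\sqcup N')$. If $W'$ is a bordism from $M$ to $N$ and $W''$ a bordism from $N$ to $P$, gluing along $N$ yields the bordism $W'\cup_N W''$ from $M$ to $P$. A homeomorphism of bordisms is a homeomorphism preserving incoming and outgoing boundaries. $(W_0,M_0,N_0)$ is a subbordism of $(W,M,N)$ if $W_0\subset W$ is a codimension $0$ submanifold, every connected component $C$ of $M_0$ satisfies $C\cap\partial W=\varnothing$ or $C\subset M$, and every connected component $C$ of $N_0$ satisfies $C\cap\partial W=\varnothing$ or $C\subset N$. A system $\mathcal{F}$ of fields assigns to each bordism $W$ a set $\mathcal{F}(W)$ and to each closed $n$-manifold $M$ a set $\mathcal{F}(M)$, with $\mathcal{F}(\varnothing)$ a one-element set, such that: (FRES) There are restriction maps $\mathcal{F}(W)\to\mathcal{F}(W_0)$ for subbordisms $W_0\subset W$, $\mathcal{F}(M)\to\mathcal{F}(M_0)$ for codimension $0$ submanifolds $M_0\subset M$, and $\mathcal{F}(W)\to\mathcal{F}(M)$ for closed codimension $1$ submanifolds $M\subset W$; they are written $f\mapsto f|_{(-)}$ and commute with each other in the obvious way (restricting in stages equals restricting directly). (FHOMEO) A homeomorphism of bordisms $\phi:W\to W'$ induces a bijection $\phi^*:\mathcal{F}(W')\to\mathcal{F}(W)$ with $(\operatorname{id}_W)^*=\operatorname{id}$, $(\psi\circ\phi)^*=\phi^*\circ\psi^*$; similarly for homeomorphisms of closed $n$-manifolds; these maps commute with the restriction maps. (FDISJ) The products of restrictions $\mathcal{F}(W\sqcup W')\to\mathcal{F}(W)\times\mathcal{F}(W')$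 and $\mathcal{F}(M\sqcup N)\to\mathcal{F}(M)\times\mathcal{F}(N)$ are bijections. (FGLUE) For $W=W'\cup_N W''$, the map $\mathcal{F}(W)\to\mathcal{F}(W')\times_{\mathcal{F}(N)}\mathcal{F}(W'')$ given by the restrictions to $W'$ and $W''$ is a bijection onto the pullback. A system $\mathbb{T}$ of $\mathbf{C}$-valued action exponentials consists of functions $\mathbb{T}_W:\mathcal{F}(W)\to\operatorname{Mor}(\mathbf{C})$ for all bordisms $W$ with $\mathbb{T}_\varnothing(p)=\operatorname{id}_I$ ($p$ the unique element of $\mathcal{F}(\varnothing)$) such that: (TDISJ) $\mathbb{T}_{W\sqcup W'}(f)=\mathbb{T}_W(f|_W)\otimes\mathbb{T}_{W'}(f|_{W'})$; (TGLUE) for $W=W'\cup_NW''$, $\mathbb{T}_W(f)=\mathbb{T}_{W''}(f|_{W''})\circ\mathbb{T}_{W'}(f|_{W'})$; (THOMEO) for a homeomorphism of bordisms $\phi:W\to W'$ and $f\in\mathcal{F}(W')$, $\mathbb{T}_W(\phi^*f)=\mathbb{T}_{W'}(f)$. For a closed $n$-manifold $M$, the state module $Z(M)$ is the set of functions $z:\mathcal{F}(M)\to Q$ with $z(\phi^*f)=z(f)$ for all $f$ and all homeomorphisms $\phi:M\to M$ isotopic to the identity; equivalently functions on the quotient $\overline{\mathcal{F}}(M)$ of $\mathcal{F}(M)$ by $f\sim\phi^*f$. $Z(M)\,\widehat{\otimes}\,Z(N)$ is the set of functions $\overline{\mathcal{F}}(M)\times\overline{\mathcal{F}}(N)\to Q$,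 also regarded as functions on $\mathcal{F}(M)\times\mathcal{F}(N)$, and identified with $Z(M\sqcup N)$ via $\mathcal{F}(M\sqcup N)\cong\mathcal{F}(M)\times\mathcal{F}(N)$. For a bordism $W$ and $F\in\mathcal{F}(W)$, $T_W(F)\in Q$ is the characteristic function of the morphism $\mathbb{T}_W(F)$ (value $1\in S$ at $\mathbb{T}_W(F)$, $0$ elsewhere). For $f\in\mathcal{F}(\partial W)$ let $\mathcal{F}(W,f)=\{F\in\mathcal{F}(W)\mid F|_{\partial W}=f\}$. The state sum $Z_W\in Z(\partial W)$ is $Z_W(f)=\sum_{F\in\mathcal{F}(W,f)}T_W(F)\in Q$. For $z\in Z(M)\,\widehat{\otimes}\,Z(N)$ and $z'\in Z(N)\,\widehat{\otimes}\,Z(P)$, the contraction $\langle z,z'\rangle\in Z(M)\,\widehat{\otimes}\,Z(P)$ is $\langle z,z'\rangle(f,h)=\sum_{g\in\mathcal{F}(N)}z(f,g)\cdot z'(g,h)$, with product in $Q^c$. Explicitly, $\pi_{M,N}(z)(f,g)=\sum_{h\in\mathcal{F}(M\times 1)}Z_{M\times[0,1]}(f,h)\cdot z(h,g)$ for $f\in\mathcal{F}(M\times 0)$, $g\in\mathcal{F}(N)$, where $M\times 0$ and $M\times 1$ are identified with $M$. *)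

(* Defs.v *)
From HB Require Import structures.
From mathcomp Require Import all_boot all_order all_algebra.
From mathcomp Require Import all_classical all_reals topology normedtype.
Set Implicit Arguments.
Unset Strict Implicit.
Unset Printing Implicit Defensive.
Import Order.TTheory GRing.Theory Num.Theory numFieldNormedType.Exports.
Local Open Scope classical_set_scope.
Local Open Scope ring_scope.

(** * Disjoint unions, homeomorphisms, manifolds *)

Definition dunion_fam (X Y : topologicalType) (b : bool) : topologicalType :=
  if b then X else Y.

Definition dunion (X Y : topologicalType) : topologicalType :=
  {b : bool & dunion_fam X Y b}.

Definition dinl (X Y : topologicalType) : X -> dunion X Y :=
  existT (dunion_fam X Y) true.
Arguments dinl {X Y} _.

Definition dinr (X Y : topologicalType) : Y -> dunion X Y :=
  existT (dunion_fam X Y) false.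
Arguments dinr {X Y} _.

Definition dcase_fam (X Y : topologicalType) (Z : Type) (f : X -> Z) (g : Y -> Z)
    (b : bool) : dunion_fam X Y b -> Z :=
  if b return dunion_fam X Y b -> Z then f else g.

Definition dcase (X Y : topologicalType) (Z : Type) (f : X -> Z) (g : Y -> Z) :
  dunion X Y -> Z := fun u => dcase_fam f g (projT2 u).

Definition dmap (X Y X' Y' : topologicalType) (f : X -> X') (g : Y -> Y') :
  dunion X Y -> dunion X' Y' := dcase (@dinl X' Y' \o f) (@dinr X' Y' \o g).

Definition homeo_between (X Y : topologicalType) (A : set X) (B : set Y)
    (f : X -> Y) (g : Y -> X) : Prop :=
  [/\ {within A, continuous f}, {within B, continuous g},
      (forall x, A x -> B (f x) /\ g (f x) = x) &
      (forall y, B y -> A (g y) /\ f (g y) = y)].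

Definition homeomorphism (X Y : topologicalType) (f : X -> Y) : Prop :=
  exists g : Y -> X, [/\ continuous f, continuous g, cancel f g & cancel g f].

(* Only used from compact spaces to Hausdorff spaces, where such a map is
   automatically a homeomorphism onto its image. *)
Definition embedding (X Y : topologicalType) (f : X -> Y) : Prop :=
  continuous f /\ injective f.

Definition locally_euclidean (R : realType) (n : nat) (X : topologicalType) :
    Prop :=
  forall x : X, exists (U : set X) (V : set 'rV[R]_n) f g,
    [/\ open_nbhs x U, open V & homeo_between U V f g].

Definition half_space (R : realType) (n : nat) : set ('rV[R]_n * R) :=
  [set p | 0 <= p.2].

(* [X] is an (n+1)-manifold whose boundary is [B]: the pair [(X, B)] is locally
   homeomorphic to the half space together with its bounding hyperplane.  By
   invariance of domain, [B] is then the set of all points of [X] that have no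
   neighbourhood homeomorphic to an open set of R^(n+1). *)
Definition manifold_with_boundary (R : realType) (n : nat)
    (X : topologicalType) (B : set X) : Prop :=
  forall x : X, exists (U : set X) (V : set ('rV[R]_n * R)) f g,
    [/\ open_nbhs x U, open V,
        homeo_between U (V `&` @half_space R n) f g &
        forall y, U y -> (B y <-> (f y).2 = 0)].

(* Second countability is omitted: it follows from compactness. *)
Record closed_manifold (R : realType) (n : nat) := ClosedManifold {
  cm_space :> topologicalType;
  cm_compact : compact [set: cm_space];
  cm_hausdorff : hausdorff_space cm_space;
  cm_charts : locally_euclidean R n cm_space }.
Arguments cm_compact {R n} M : rename.
Arguments cm_hausdorff {R n} M : rename.
Arguments cm_charts {R n} M : rename.

(** * Bordisms *)

(* The identification of the boundary of [W] with the disjoint union of [M] and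
   [N] is carried by the two embeddings [bin] and [bout]. *)
Record bordism (R : realType) (n : nat) (M N : closed_manifold R n) :=
  Bordism {
    bd_space :> topologicalType;
    bin : M -> bd_space;
    bout : N -> bd_space;
    bd_compact : compact [set: bd_space];
    bd_hausdorff : hausdorff_space bd_space;
    bin_embedding : embedding bin;
    bout_embedding : embedding bout;
    bin_bout : forall x y, bin x <> bout y;
    bd_charts :
      @manifold_with_boundary R n bd_space (range bin `|` range bout) }.
Arguments bin {R n M N} _ _.
Arguments bout {R n M N} _ _.
Arguments bd_compact {R n M N} W : rename.
Arguments bd_hausdorff {R n M N} W : rename.
Arguments bin_embedding {R n M N} W : rename.
Arguments bout_embedding {R n M N} W : rename.
Arguments bin_bout {R n M N} W : rename.
Arguments bd_charts {R n M N} W : rename.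

Definition bordism_boundary (R : realType) (n : nat) (M N : closed_manifold R n)
  (W : bordism M N) : set W := range (bin W) `|` range (bout W).
Arguments bordism_boundary {R n M N} _ _.

Definition bordism_homeo (R : realType) (n : nat)
    (M N M' N' : closed_manifold R n) (W : bordism M N) (W' : bordism M' N')
    (phi : W -> W') : Prop :=
  [/\ homeomorphism phi,
      phi @` range (bin W) = range (bin W') &
      phi @` range (bout W) = range (bout W')].

(* [j] identifies [W0] with a subbordism of [W]; connected components of the
   incoming (outgoing) boundary of [W0] are those of [M0] ([N0]). *)
Definition subbordism (R : realType) (n : nat)
    (M0 N0 M N : closed_manifold R n) (W0 : bordism M0 N0) (W : bordism M N)
    (j : W0 -> W) : Prop :=
  [/\ embedding j,
      forall x : M0, let C := (j \o bin W0) @` connected_component setT x in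
        C `&` bordism_boundary W = set0 \/ C `<=` range (bin W) &
      forall x : N0, let C := (j \o bout W0) @` connected_component setT x in
        C `&` bordism_boundary W = set0 \/ C `<=` range (bout W)].

(* [W] is obtained by gluing [W'] and [W''] along [N]: by compactness, the
   conditions say exactly that the map from the pushout of [bout W'] and
   [bin W''] to [W] induced by [j'] and [j''] is a homeomorphism, compatibly
   with the incoming boundary [M] and the outgoing boundary [P]. *)
Definition is_gluing (R : realType) (n : nat) (M N P : closed_manifold R n)
    (W' : bordism M N) (W'' : bordism N P) (W : bordism M P)
    (j' : W' -> W) (j'' : W'' -> W) : Prop :=
  [/\ [/\ embedding j', embedding j'' & range j' `|` range j'' = setT],
      forall x y, j' x = j'' y <-> exists z, x = bout W' z /\ y = bin W'' z,
      bin W = j' \o bin W' &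
      bout W = j'' \o bout W''].

(** * Constructions of manifolds and bordisms *)

Lemma dunion_ind (X Y : topologicalType) (P : dunion X Y -> Prop) :
  (forall x, P (dinl x)) -> (forall y, P (dinr y)) -> forall u, P u.
Proof. by move=> hl hr [[] z]; [exact: hl|exact: hr]. Qed.

Lemma dinl_continuous (X Y : topologicalType) : continuous (@dinl X Y).
Proof. exact: (@existT_continuous _ (dunion_fam X Y) true). Qed.

Lemma dinr_continuous (X Y : topologicalType) : continuous (@dinr X Y).
Proof. exact: (@existT_continuous _ (dunion_fam X Y) false). Qed.

Lemma dinl_open (X Y : topologicalType) (A : set X) :
  open A -> open (@dinl X Y @` A).
Proof. exact: (@existT_open_map _ (dunion_fam X Y) true). Qed.

Lemma dinr_open (X Y : topologicalType) (A : set Y) :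
  open A -> open (@dinr X Y @` A).
Proof. exact: (@existT_open_map _ (dunion_fam X Y) false). Qed.

Lemma dinl_inj (X Y : topologicalType) : injective (@dinl X Y).
Proof. by move=> x y /(congr1 (dcase Some (fun=> None))) []. Qed.

Lemma dinr_inj (X Y : topologicalType) : injective (@dinr X Y).
Proof. by move=> x y /(congr1 (dcase (fun=> None) Some)) []. Qed.

Lemma dinl_dinr (X Y : topologicalType) (x : X) (y : Y) : dinl x <> dinr y.
Proof. by move/(congr1 (dcase xpredT xpred0)). Qed.

Lemma dcase_continuous (X Y Z : topologicalType) (f : X -> Z) (g : Y -> Z) :
  continuous f -> continuous g -> continuous (dcase f g).
Proof.
move=> cf cg; apply: (@sigT_continuous _ (dunion_fam X Y)).
by case; [exact: cf|exact: cg].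
Qed.

Lemma cluster_image (X Y : topologicalType) (f : X -> Y) (p q : X) :
  continuous f -> cluster (nbhs p) q -> cluster (nbhs (f p)) (f q).
Proof.
move=> cf pq A B /cf nA /cf nB.
by have [z [Az Bz]] := pq _ _ nA nB; exists (f z).
Qed.

Lemma hausdorff_inj (X Y : topologicalType) (f : X -> Y) :
  continuous f -> injective f -> hausdorff_space Y -> hausdorff_space X.
Proof. by move=> cf fi hY p q pq; apply/fi/hY/cluster_image. Qed.

Lemma hausdorff_prod (X Y : topologicalType) :
  hausdorff_space X -> hausdorff_space Y -> hausdorff_space (X * Y)%type.
Proof.
move=> hX hY [x y] [x' y'] h; congr pair.
  apply: hX; apply: (@cluster_image (X * Y)%type X fst (x, y) (x', y')) => //.
  by move=> z; exact: cvg_fst.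
apply: hY; apply: (@cluster_image (X * Y)%type Y snd (x, y) (x', y')) => //.
by move=> z; exact: cvg_snd.
Qed.

Lemma hausdorff_dunion (X Y : topologicalType) :
  hausdorff_space X -> hausdorff_space Y -> hausdorff_space (dunion X Y).
Proof.
move=> hX hY.
have nl (x : X) (A : set X) : nbhs x A -> nbhs (@dinl X Y x) (@dinl X Y @` A).
  exact: (@existT_nbhs _ (dunion_fam X Y) true).
have nr (x : Y) (A : set Y) : nbhs x A -> nbhs (@dinr X Y x) (@dinr X Y @` A).
  exact: (@existT_nbhs _ (dunion_fam X Y) false).
elim/dunion_ind=> x; elim/dunion_ind=> y h.
- congr dinl; apply: hX => A B /nl nA /nl nB.
  have [_ [[a Aa <-] [b Bb /dinl_inj ba]]] := h _ _ nA nB.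
  by exists a; split => //; rewrite -ba.
- have [_ [[a _ <-] [b _ ba]]] := h _ _ (nl _ _ filterT) (nr _ _ filterT).
  by case: (dinl_dinr (esym ba)).
- have [_ [[a _ <-] [b _ ba]]] := h _ _ (nr _ _ filterT) (nl _ _ filterT).
  by case: (dinl_dinr ba).
- congr dinr; apply: hY => A B /nr nA /nr nB.
  have [_ [[a Aa <-] [b Bb /dinr_inj ba]]] := h _ _ nA nB.
  by exists a; split => //; rewrite -ba.
Qed.

Lemma compact_dunion (X Y : topologicalType) :
  compact [set: X] -> compact [set: Y] -> compact [set: dunion X Y].
Proof.
move=> cX cY; apply: (@sigT_compact _ (dunion_fam X Y)).
  exact: finite_finset.
by case; [exact: cX|exact: cY].
Qed.

Lemma homeo_between_open_image (X Y Z : topologicalType) (e : X -> Z)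
    (r : Z -> X) (A : set X) (B : set Y) (f : X -> Y) (g : Y -> X) :
  continuous e -> continuous r -> cancel e r -> open A -> open (e @` A) ->
  homeo_between A B f g -> homeo_between (e @` A) B (f \o r) (e \o g).
Proof.
move=> ce cr er oA oeA [cf cg fg gf]; split.
- move: cf; rewrite !continuous_open_subspace// => cf _ /set_mem[x Ax <-].
  apply: continuous_comp; first exact: cr.
  by apply: cf; rewrite er inE.
- move=> y; apply: (@continuous_comp (subspace B) X Z g e); first exact: cg.
  exact: ce.
- by move=> _ [x Ax <-]/=; rewrite er; have [Bf ->] := fg _ Ax.
- by move=> y /gf[Ag fgy]; split=> /=; [exists (g y)|rewrite er].
Qed.

Lemma locally_euclidean_dunion (R : realType) (n : nat)
    (X Y : topologicalType) :
  locally_euclidean R n X -> locally_euclidean R n Y ->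
  locally_euclidean R n (dunion X Y).
Proof.
move=> hX hY; elim/dunion_ind=> x.
- have [U [V [f [g [[oU Ux] oV h]]]]] := hX x.
  exists (@dinl X Y @` U), V, (f \o dcase id (fun=> x)), (@dinl X Y \o g).
  split=> //; first by split; [exact: dinl_open|exists x].
  apply: homeo_between_open_image => //; [exact: dinl_continuous| |].
    by apply: dcase_continuous => ?; [exact: cvg_id|exact: cvg_cst].
  exact: dinl_open.
- have [U [V [f [g [[oU Ux] oV h]]]]] := hY x.
  exists (@dinr X Y @` U), V, (f \o dcase (fun=> x) id), (@dinr X Y \o g).
  split=> //; first by split; [exact: dinr_open|exists x].
  apply: homeo_between_open_image => //; [exact: dinr_continuous| |].
    by apply: dcase_continuous => ?; [exact: cvg_cst|exact: cvg_id].
  exact: dinr_open.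
Qed.

Lemma manifold_with_boundary_dunion (R : realType) (n : nat)
    (X Y : topologicalType) (A : set X) (B : set Y) (D : set (dunion X Y)) :
  (forall x, D (dinl x) <-> A x) -> (forall y, D (dinr y) <-> B y) ->
  manifold_with_boundary R n A -> manifold_with_boundary R n B ->
  manifold_with_boundary R n D.
Proof.
move=> DA DB hX hY; elim/dunion_ind=> x.
- have [U [V [f [g [[oU Ux] oV h hA]]]]] := hX x.
  exists (@dinl X Y @` U), V, (f \o dcase id (fun=> x)), (@dinl X Y \o g).
  split=> //; first by split; [exact: dinl_open|exists x].
  + apply: homeo_between_open_image => //; [exact: dinl_continuous| |].
      by apply: dcase_continuous => ?; [exact: cvg_id|exact: cvg_cst].
    exact: dinl_open.
  + by move=> _ [y Uy <-]; rewrite DA; exact: hA.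
- have [U [V [f [g [[oU Ux] oV h hB]]]]] := hY x.
  exists (@dinr X Y @` U), V, (f \o dcase (fun=> x) id), (@dinr X Y \o g).
  split=> //; first by split; [exact: dinr_open|exists x].
  + apply: homeo_between_open_image => //; [exact: dinr_continuous| |].
      by apply: dcase_continuous => ?; [exact: cvg_cst|exact: cvg_id].
    exact: dinr_open.
  + by move=> _ [y Uy <-]; rewrite DB; exact: hB.
Qed.

Lemma embedding_comp (X Y Z : topologicalType) (f : X -> Y) (g : Y -> Z) :
  embedding f -> embedding g -> embedding (g \o f).
Proof.
move=> [cf fi] [cg gi]; split; last exact: inj_comp.
by move=> x; apply: continuous_comp; [exact: cf|exact: cg].
Qed.

Lemma dinl_embedding (X Y : topologicalType) : embedding (@dinl X Y).
Proof. by split; [exact: dinl_continuous|exact: dinl_inj]. Qed.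

Lemma dinr_embedding (X Y : topologicalType) : embedding (@dinr X Y).
Proof. by split; [exact: dinr_continuous|exact: dinr_inj]. Qed.

Lemma dcase_embedding (X Y Z : topologicalType) (f : X -> Z) (g : Y -> Z) :
  embedding f -> embedding g -> (forall x y, f x <> g y) ->
  embedding (dcase f g).
Proof.
move=> [cf fi] [cg gi] fg; split; first exact: dcase_continuous.
elim/dunion_ind=> x; elim/dunion_ind=> y /= h.
- by congr dinl; exact: fi.
- by case: (fg x y).
- by case: (fg y x).
- by congr dinr; exact: gi.
Qed.

Lemma dmap_embedding (X Y X' Y' : topologicalType) (f : X -> X') (g : Y -> Y') :
  embedding f -> embedding g -> embedding (dmap f g).
Proof.
move=> hf hg; apply: dcase_embedding; last by move=> x y; exact: dinl_dinr.
- by apply: embedding_comp => //; exact: dinl_embedding.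
- by apply: embedding_comp => //; exact: dinr_embedding.
Qed.

Definition cm_union (R : realType) (n : nat) (M N : closed_manifold R n) :
    closed_manifold R n :=
  @ClosedManifold R n (dunion M N)
    (compact_dunion (cm_compact M) (cm_compact N))
    (hausdorff_dunion (cm_hausdorff M) (cm_hausdorff N))
    (locally_euclidean_dunion (cm_charts M) (cm_charts N)).

Lemma boundary_embedding (R : realType) (n : nat) (M N : closed_manifold R n)
    (W : bordism M N) :
  @embedding (cm_union M N) W (dcase (bin W) (bout W)).
Proof.
apply: dcase_embedding; [exact: bin_embedding|exact: bout_embedding|].
exact: bin_bout.
Qed.

Lemma bordism_union_disjoint (R : realType) (n : nat)
    (M N M' N' : closed_manifold R n) (W : bordism M N) (W' : bordism M' N')
    (x : cm_union M M') (y : cm_union N N') :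
  dmap (bin W) (bin W') x <> dmap (bout W) (bout W') y.
Proof.
elim/dunion_ind: x => x; elim/dunion_ind: y => y /=.
- by move/dinl_inj; exact: bin_bout.
- exact: dinl_dinr.
- by move/esym; exact: dinl_dinr.
- by move/dinr_inj; exact: bin_bout.
Qed.

Lemma bordism_union_charts (R : realType) (n : nat)
    (M N M' N' : closed_manifold R n) (W : bordism M N) (W' : bordism M' N') :
  @manifold_with_boundary R n (dunion W W')
    (range (dmap (bin W) (bin W')) `|` range (dmap (bout W) (bout W'))).
Proof.
apply: manifold_with_boundary_dunion (bd_charts W)
  (bd_charts W') => z; split.
- case=> -[u _]; elim/dunion_ind: u => u /=.
  + by move/dinl_inj <-; left; exists u.
  + by move/esym/dinl_dinr.
  + by move/dinl_inj <-; right; exists u.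
  + by move/esym/dinl_dinr.
- by case=> -[u _ <-]; [left|right]; exists (dinl u).
- case=> -[u _]; elim/dunion_ind: u => u /=.
  + by move/dinl_dinr.
  + by move/dinr_inj <-; left; exists u.
  + by move/dinl_dinr.
  + by move/dinr_inj <-; right; exists u.
- by case=> -[u _ <-]; [left|right]; exists (dinr u).
Qed.

Definition bordism_union (R : realType) (n : nat)
    (M N M' N' : closed_manifold R n) (W : bordism M N) (W' : bordism M' N') :
    bordism (cm_union M M') (cm_union N N') :=
  @Bordism R n (cm_union M M') (cm_union N N') (dunion W W')
    (dmap (bin W) (bin W')) (dmap (bout W) (bout W'))
    (compact_dunion (bd_compact W) (bd_compact W'))
    (hausdorff_dunion (bd_hausdorff W) (bd_hausdorff W'))
    (dmap_embedding (bin_embedding W) (bin_embedding W'))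
    (dmap_embedding (bout_embedding W) (bout_embedding W'))
    (@bordism_union_disjoint R n M N M' N' W W')
    (@bordism_union_charts R n M N M' N' W W').

(** ** The cylinder *)

Definition unit_interval (R : realType) : topologicalType :=
  set_type ([set` `[0, 1]] : set R).

Lemma unit_interval0 (R : realType) : (0 : R) \in ([set` `[0, 1]] : set R).
Proof. by rewrite inE /= in_itv /= lexx ler01. Qed.

Lemma unit_interval1 (R : realType) : (1 : R) \in ([set` `[0, 1]] : set R).
Proof. by rewrite inE /= in_itv /= lexx ler01. Qed.

Definition i0 (R : realType) : unit_interval R := exist _ 0 (unit_interval0 R).

Definition i1 (R : realType) : unit_interval R := exist _ 1 (unit_interval1 R).

Lemma clamp_subproof (R : realType) (s : R) :
  Num.max 0 (Num.min 1 s) \in ([set` `[0, 1]] : set R).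
Proof.
by rewrite inE /= in_itv /= le_max lexx /= ge_max ler01 ge_min lexx.
Qed.

Definition clamp (R : realType) (s : R) : unit_interval R :=
  exist _ (Num.max 0 (Num.min 1 s)) (clamp_subproof s).

Lemma clamp_continuous (R : realType) : continuous (@clamp R).
Proof.
apply: (@continuous_comp_initial (unit_interval R) R R set_val (@clamp R)).
move=> s; rewrite /comp /=.
apply: (@continuous_max _ R (fun=> 0) (fun s : R => Num.min 1 s)).
  exact: cvg_cst.
apply: (@continuous_min _ R (fun=> 1) (fun s : R => s)).
  exact: cvg_cst.
exact: cvg_id.
Qed.

Lemma val_unit_interval (R : realType) (t : unit_interval R) :
  0 <= val t <= 1.
Proof. by case: t => t /=; rewrite inE /= in_itv. Qed.

Lemma clamp_val (R : realType) (t : unit_interval R) : clamp (val t) = t.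
Proof.
apply: val_inj => /=; have /andP[t0 t1] := val_unit_interval t.
by rewrite (min_idPr t1) (max_idPr t0).
Qed.

Lemma val_clamp (R : realType) (s : R) : 0 <= s <= 1 -> val (clamp s) = s.
Proof. by move=> /andP[s0 s1] /=; rewrite (min_idPr s1) (max_idPr s0). Qed.

Lemma val_continuous (R : realType) :
  continuous (fun t : unit_interval R => val t).
Proof. exact: (@initial_continuous (unit_interval R) R set_val). Qed.

Lemma compact_unit_interval (R : realType) : compact [set: unit_interval R].
Proof.
have -> : [set: unit_interval R] = @clamp R @` [set` `[0, 1]].
  apply/seteqP; split=> // t _; exists (val t); last exact: clamp_val.
  by rewrite /= in_itv; exact: val_unit_interval.
apply: continuous_compact; last exact: segment_compact.
by apply: continuous_subspaceT; exact: clamp_continuous.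
Qed.

Lemma hausdorff_unit_interval (R : realType) :
  hausdorff_space (unit_interval R).
Proof.
apply: hausdorff_inj (@val_continuous R) _ _; first exact: val_inj.
exact: Rhausdorff.
Qed.

Definition cyl_in (R : realType) (M : topologicalType) (x : M) :
  (M * unit_interval R)%type := (x, i0 R).

Definition cyl_out (R : realType) (M : topologicalType) (x : M) :
  (M * unit_interval R)%type := (x, i1 R).

Lemma continuous_fst_comp (X Y Z : topologicalType) (h : X -> Z)
    (p : (X * Y)%type) :
  {for p.1, continuous h} -> {for p, continuous (fun q : X * Y => h q.1)}.
Proof. by move=> ch A /ch; exact: filter_prod1. Qed.

Lemma continuous_snd_comp (X Y Z : topologicalType) (h : Y -> Z)
    (p : (X * Y)%type) :
  {for p.2, continuous h} -> {for p, continuous (fun q : X * Y => h q.2)}.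
Proof. by move=> ch A /ch; exact: filter_prod2. Qed.

Lemma continuous_pair (X Y Z : topologicalType) (f : X -> Y) (g : X -> Z)
    (x : X) :
  {for x, continuous f} -> {for x, continuous g} ->
  {for x, continuous (fun x => (f x, g x))}.
Proof. by move=> cf cg; exact: cvg_pair. Qed.

Lemma cyl_in_embedding (R : realType) (M : topologicalType) :
  embedding (@cyl_in R M).
Proof.
split=> [x|x y [//]].
by apply: continuous_pair; [exact: cvg_id|exact: cvg_cst].
Qed.

Lemma cyl_out_embedding (R : realType) (M : topologicalType) :
  embedding (@cyl_out R M).
Proof.
split=> [x|x y [//]].
by apply: continuous_pair; [exact: cvg_id|exact: cvg_cst].
Qed.

Lemma cyl_in_out (R : realType) (M : topologicalType) (x y : M) :
  cyl_in R x <> cyl_out R y.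
Proof. by move=> [_ /esym/eqP]; rewrite oner_eq0. Qed.

Lemma compact_cylinder (R : realType) (M : topologicalType) :
  compact [set: M] -> compact [set: (M * unit_interval R)%type].
Proof.
move=> cM; rewrite -setXTT.
by apply: compact_setX; [exact: cM|exact: compact_unit_interval].
Qed.

Lemma cylinder_chart (R : realType) (n : nat) (M : topologicalType)
    (U : set M) (V : set 'rV[R]_n) (f : M -> 'rV[R]_n) (g : 'rV[R]_n -> M)
    (s : unit_interval R -> unit_interval R) (x : M) (t : unit_interval R) :
  open_nbhs x U -> open V -> homeo_between U V f g ->
  continuous s -> involutive s -> val (s t) < 1 ->
  (forall u, (u = i0 R \/ u = i1 R) <-> (s u = i0 R \/ s u = i1 R)) ->
  exists (U' : set (M * unit_interval R)) (V' : set ('rV[R]_n * R)) f' g',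
    [/\ open_nbhs (x, t) U', open V',
        homeo_between U' (V' `&` @half_space R n) f' g' &
        forall y, U' y ->
          ((range (@cyl_in R M) `|` range (@cyl_out R M)) y <-> (f' y).2 = 0)].
Proof.
move=> [oU Ux] oV [cf cg fg gf] cs ss st1 s01.
pose U' := [set p : M * unit_interval R | U p.1 /\ val (s p.2) < 1].
pose V' := [set p : 'rV[R]_n * R | V p.1 /\ p.2 < 1].
have vs_continuous : continuous (fun u => val (s u)).
  by move=> u; apply: (continuous_comp (cs u)); exact: val_continuous.
have oU' : open U'.
  apply: openI.
    apply: (@open_comp (M * unit_interval R)%type M fst U) => // ? _.
    exact: cvg_fst.
  apply: (@open_comp (M * unit_interval R)%type R (fun p => val (s p.2))
    [set r | r < 1]); last exact: open_lt.
  move=> p _; apply: (@continuous_snd_comp M _ _ (fun u => val (s u))).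
  exact: vs_continuous.
have oV' : open V'.
  apply: openI.
    apply: (@open_comp ('rV[R]_n * R)%type 'rV[R]_n fst V) => // ? _.
    exact: cvg_fst.
  apply: (@open_comp ('rV[R]_n * R)%type R snd [set r | r < 1]);
    last exact: open_lt.
  by move=> ? _; exact: cvg_snd.
exists U', V', (fun p => (f p.1, val (s p.2))),
  (fun p => (g p.1, s (clamp p.2))).
split=> //.
- split.
  + rewrite continuous_open_subspace// => -[y u] /set_mem[/= Uy _].
    apply: (@continuous_pair _ _ _ (fun p : M * unit_interval R => f p.1)
      (fun p => val (s p.2))).
      apply: (@continuous_fst_comp M _ _ f (y, u)).
      by move: cf; rewrite continuous_open_subspace//; apply; rewrite inE.
    apply: (@continuous_snd_comp M _ _ (fun u => val (s u)) (y, u)).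
    exact: vs_continuous.
  + apply: continuous_in_subspaceT => -[v r] /set_mem[[/= Vv _] _].
    apply: (@continuous_pair _ _ _ (fun p : 'rV[R]_n * R => g p.1)
      (fun p => s (clamp p.2))).
      apply: (@continuous_fst_comp _ R _ g (v, r)).
      by move: cg; rewrite continuous_open_subspace//; apply; rewrite inE.
    apply: (@continuous_snd_comp _ R _ (fun u => s (clamp u)) (v, r)).
    by apply: continuous_comp; [exact: clamp_continuous|exact: cs].
  + move=> [y u] [/= Uy u1]; have [Vf gfy] := fg _ Uy.
    rewrite clamp_val ss gfy; split=> //; split=> //.
    by rewrite /half_space /=; have /andP[] := val_unit_interval (s u).
  + move=> [v r] [[/= Vv r1] r0]; have [Ug fgv] := gf _ Vv.
    have cr : val (clamp r) = r by apply: val_clamp; rewrite (r0 : 0 <= r) ltW.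
    rewrite /U' /= ss [X in (_, X)]cr fgv; do 2 split => //.
    by rewrite [X in X < _]cr.
- move=> [y u] [/= Uy u1]; split.
    have u01 : (u = i0 R \/ u = i1 R) -> val (s u) = 0.
      move/s01 => -[-> //|su]; move: u1.
      by rewrite su /= ltxx.
    by case=> -[z _ [_ uz]]; apply: u01; [left|right].
  move=> su0; have : u = i0 R \/ u = i1 R.
    by apply: (s01 u).2; left; exact: val_inj.
  by case=> ->; [left|right]; exists y.
Qed.

Lemma cylinder_charts (R : realType) (n : nat) (M : topologicalType) :
  locally_euclidean R n M ->
  manifold_with_boundary R n (range (@cyl_in R M) `|` range (@cyl_out R M)).
Proof.
move=> hM [x t]; have [U [V [f [g [xU oV h]]]]] := hM x.
have [t1|t1] := ltP (val t) 1.
  apply: (@cylinder_chart R n M U V f g id x t) => //.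
  by move=> u; exact: cvg_id.
pose s (u : unit_interval R) : unit_interval R := clamp (1 - val u).
have vs u : val (s u) = 1 - val u.
  apply: val_clamp; have /andP[u0 u1] := val_unit_interval u.
  by rewrite subr_ge0 u1 lerBlDr lerDl.
have s0 u : u = i0 R -> s u = i1 R.
  by move=> ->; apply: val_inj; rewrite vs /= subr0.
have s1 u : u = i1 R -> s u = i0 R.
  by move=> ->; apply: val_inj; rewrite vs /= subrr.
have ss : involutive s by move=> u; apply: val_inj; rewrite !vs subKr.
apply: (@cylinder_chart R n M U V f g s x t) => //.
- have c1 : continuous (fun r : R => 1 - r).
    by move=> r; apply: continuousB; [exact: cst_continuous|exact: cvg_id].
  have c2 : continuous (fun u : unit_interval R => 1 - val u).
    by move=> u; exact: (continuous_comp (@val_continuous R u) (c1 (val u))).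
  by move=> u; exact: (continuous_comp (c2 u) (@clamp_continuous R _)).
- by rewrite vs ltrBlDr ltrDl (lt_le_trans _ t1).
- by move=> u; split=> -[]; [move/s0|move/s1|move/s0|move/s1]; rewrite ?ss;
    by [left|right].
Qed.

Definition cylinder (R : realType) (n : nat) (M : closed_manifold R n) :
    bordism M M :=
  @Bordism R n M M (M * unit_interval R)%type
    (@cyl_in R M) (@cyl_out R M)
    (@compact_cylinder R M (cm_compact M))
    (hausdorff_prod (cm_hausdorff M) (@hausdorff_unit_interval R))
    (@cyl_in_embedding R M) (@cyl_out_embedding R M) (@cyl_in_out R M)
    (cylinder_charts (cm_charts M)).

Lemma homeomorphism_embedding (X Y : topologicalType) (f : X -> Y) :
  homeomorphism f -> embedding f.
Proof. by move=> [g [cf _ fK _]]; split; [exact: cf|exact: can_inj fK]. Qed.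

Lemma bordism_homeo_subbordism (R : realType) (n : nat)
    (M N M' N' : closed_manifold R n) (W : bordism M N) (W' : bordism M' N')
    (phi : W -> W') :
  bordism_homeo phi -> subbordism phi.
Proof.
move=> [hphi hin hout]; split; first exact: homeomorphism_embedding.
- by move=> x /=; right=> _ [y _ <-]; rewrite -hin; exists (bin W y).
- by move=> x /=; right=> _ [y _ <-]; rewrite -hout; exists (bout W y).
Qed.

Lemma bordism_unionl_subbordism (R : realType) (n : nat)
    (M N M' N' : closed_manifold R n) (W : bordism M N) (W' : bordism M' N') :
  @subbordism R n M N _ _ W (bordism_union W W') dinl.
Proof.
split; first exact: dinl_embedding.
- by move=> x /=; right=> _ [y _ <-]; exists (dinl y).
- by move=> x /=; right=> _ [y _ <-]; exists (dinl y).
Qed.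

Lemma bordism_unionr_subbordism (R : realType) (n : nat)
    (M N M' N' : closed_manifold R n) (W : bordism M N) (W' : bordism M' N') :
  @subbordism R n M' N' _ _ W' (bordism_union W W') dinr.
Proof.
split; first exact: dinr_embedding.
- by move=> x /=; right=> _ [y _ <-]; exists (dinr y).
- by move=> x /=; right=> _ [y _ <-]; exists (dinr y).
Qed.

Lemma gluingl_subbordism (R : realType) (n : nat) (M N P : closed_manifold R n)
    (W' : bordism M N) (W'' : bordism N P) (W : bordism M P)
    (j' : W' -> W) (j'' : W'' -> W) :
  is_gluing j' j'' -> subbordism j'.
Proof.
move=> [[ej' ej'' _] glue Win Wout]; split=> // x /=.
  by right=> _ [y _ <-]; rewrite Win; exists y.
left; apply/seteqP; split=> // w [[y _ <-] [[z _]|[z _]]] /=.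
- by rewrite Win => /ej'.2 zy; have := bin_bout W' z y.
- move=> /esym; rewrite Wout => /glue[u [_ /esym]]; exact: bin_bout.
Qed.

Lemma gluingr_subbordism (R : realType) (n : nat) (M N P : closed_manifold R n)
    (W' : bordism M N) (W'' : bordism N P) (W : bordism M P)
    (j' : W' -> W) (j'' : W'' -> W) :
  is_gluing j' j'' -> subbordism j''.
Proof.
move=> [[ej' ej'' _] glue Win Wout]; split=> // x /=; last first.
  by right=> _ [y _ <-]; rewrite Wout; exists y.
left; apply/seteqP; split=> // w [[y _ <-] [[z _]|[z _]]] /=.
- by rewrite Win => /glue[u [+ _]]; exact: bin_bout.
- by rewrite Wout => /ej''.2 /esym; exact: bin_bout.
Qed.

(** * Complete semirings and strict monoidal categories *)

(* In [csum1] and [csum2], the index sets {1} and {1,2} are arbitrary types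
   with one, respectively two, elements; in [csum_partition], the blocks of the
   partition are the fibres of [p]. *)
Record complete_semiring := CompleteSemiring {
  cs_semiring :> pzSemiRingType;
  csum : forall I : Type, (I -> cs_semiring) -> cs_semiring;
  csum0 : forall (I : Type) (m : I -> cs_semiring),
    (I -> False) -> csum m = 0;
  csum1 : forall (I : Type) (m : I -> cs_semiring) (a : I),
    (forall i, i = a) -> csum m = m a;
  csum2 : forall (I : Type) (m : I -> cs_semiring) (a b : I),
    a <> b -> (forall i, i = a \/ i = b) -> csum m = m a + m b;
  csum_partition : forall (I J : Type) (p : I -> J) (m : I -> cs_semiring),
    csum (fun j => csum (fun i : {i : I | p i = j} => m (sval i))) = csum m;
  csumMl : forall (I : Type) (m : I -> cs_semiring) (s : cs_semiring),
    csum (fun i => s * m i) = s * csum m;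
  csumMr : forall (I : Type) (m : I -> cs_semiring) (s : cs_semiring),
    csum (fun i => m i * s) = csum m * s }.
Arguments csum S {I} m : rename.

(* [scomp b a] is the composite of [a] followed by [b]; it is meaningful only
   when [scod a = sdom b]. *)
Record strict_monoidal_category := StrictMonoidalCategory {
  sob : Type;
  smor : Type;
  sdom : smor -> sob;
  scod : smor -> sob;
  sid : sob -> smor;
  scomp : smor -> smor -> smor;
  sdom_id : forall x, sdom (sid x) = x;
  scod_id : forall x, scod (sid x) = x;
  sdom_comp : forall b a, scod a = sdom b -> sdom (scomp b a) = sdom a;
  scod_comp : forall b a, scod a = sdom b -> scod (scomp b a) = scod b;
  scomp_idl : forall a, scomp (sid (scod a)) a = a;
  scomp_idr : forall a, scomp a (sid (sdom a)) = a;
  scompA : forall c b a, scod a = sdom b -> scod b = sdom c ->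
    scomp c (scomp b a) = scomp (scomp c b) a;
  otensor : sob -> sob -> sob;
  sunit : sob;
  stensor : smor -> smor -> smor;
  sdom_tensor : forall a b, sdom (stensor a b) = otensor (sdom a) (sdom b);
  scod_tensor : forall a b, scod (stensor a b) = otensor (scod a) (scod b);
  stensor_id : forall x y, stensor (sid x) (sid y) = sid (otensor x y);
  stensor_comp : forall b a b' a', scod a = sdom b -> scod a' = sdom b' ->
    stensor (scomp b a) (scomp b' a') = scomp (stensor b b') (stensor a a');
  otensorA : forall x y z,
    otensor (otensor x y) z = otensor x (otensor y z);
  otensor1x : forall x, otensor sunit x = x;
  otensorx1 : forall x, otensor x sunit = x;
  stensorA : forall a b c,
    stensor (stensor a b) c = stensor a (stensor b c);
  stensor1x : forall a, stensor (sid sunit) a = a;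
  stensorx1 : forall a, stensor a (sid sunit) = a }.
Arguments sunit C : rename.

Definition Qmod (S : complete_semiring) (C : strict_monoidal_category) : Type :=
  smor C -> S.

Definition Qsum (S : complete_semiring) (C : strict_monoidal_category)
    (I : Type) (a : I -> Qmod S C) : Qmod S C :=
  fun gamma => csum S (fun i => a i gamma).

(* The product of the composition semiring; the sum runs over the
   factorizations of [gamma] as [p.1] after [p.2]. *)
Definition Qmul (S : complete_semiring) (C : strict_monoidal_category)
    (a b : Qmod S C) : Qmod S C :=
  fun gamma => csum S
    (fun p : {p : smor C * smor C |
                scod p.2 = sdom p.1 /\ scomp p.1 p.2 = gamma} =>
       b (sval p).1 * a (sval p).2).

Definition Qchar (S : complete_semiring) (C : strict_monoidal_category)
    (alpha : smor C) : Qmod S C :=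
  fun gamma => if `[< gamma = alpha >] then 1 else 0.

(** * Systems of fields and action exponentials *)

(* Submanifolds are given as embeddings [j] rather than as subsets.  The map
   [resM j] (resp. [resW j], [resB j]) is restriction to the image of [j]
   followed by the pull-back along the homeomorphism from the source of [j] to
   this image.  In particular, restriction to a subset is the case where [j] is
   an inclusion, and the bijection induced by a homeomorphism [phi] is [resM
   phi] or [resW phi]; functoriality of the pull-backs, transitivity of the
   restrictions and the compatibility of both are the identity and composition
   laws below. *)
Record field_system (R : realType) (n : nat) := FieldSystem {
  FM :> closed_manifold R n -> Type;
  FW : forall M N : closed_manifold R n, bordism M N -> Type;

  resM : forall (M0 M : closed_manifold R n) (j : M0 -> M),
    embedding j -> FM M -> FM M0;
  resW : forall (M0 N0 M N : closed_manifold R n) (W0 : bordism M0 N0)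
    (W : bordism M N) (j : W0 -> W), subbordism j -> FW W -> FW W0;
  resB : forall (L M N : closed_manifold R n) (W : bordism M N) (j : L -> W),
    embedding j -> FW W -> FM L;

  FM_empty : forall M : closed_manifold R n, (M -> False) ->
    exists! f : FM M, True;
  FW_empty : forall (M N : closed_manifold R n) (W : bordism M N),
    (W -> False) -> exists! f : FW W, True;

  resM_id : forall (M : closed_manifold R n) (h : embedding (@id M)) f,
    resM h f = f;
  resM_comp : forall (M0 M1 M2 : closed_manifold R n) (i : M0 -> M1)
    (j : M1 -> M2) (hi : embedding i) (hj : embedding j)
    (hji : embedding (j \o i)) f,
    resM hi (resM hj f) = resM hji f;
  resW_id : forall (M N : closed_manifold R n) (W : bordism M N)
    (h : subbordism (@id W)) f,
    resW h f = f;
  resW_comp : forall (M0 N0 M1 N1 M2 N2 : closed_manifold R n)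
    (W0 : bordism M0 N0) (W1 : bordism M1 N1) (W2 : bordism M2 N2)
    (i : W0 -> W1) (j : W1 -> W2) (hi : subbordism i) (hj : subbordism j)
    (hji : subbordism (j \o i)) f,
    resW hi (resW hj f) = resW hji f;
  resM_resB : forall (L0 L M N : closed_manifold R n) (W : bordism M N)
    (i : L0 -> L) (j : L -> W) (hi : embedding i) (hj : embedding j)
    (hji : embedding (j \o i)) f,
    resM hi (resB hj f) = resB hji f;
  resB_resW : forall (L M0 N0 M N : closed_manifold R n)
    (W0 : bordism M0 N0) (W : bordism M N) (i : L -> W0) (j : W0 -> W)
    (hi : embedding i) (hj : subbordism j) (hji : embedding (j \o i)) f,
    resB hi (resW hj f) = resB hji f;

  FM_disj : forall (M N : closed_manifold R n) (f : FM M) (g : FM N),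
    exists! h : FM (cm_union M N),
      @resM M (cm_union M N) dinl (@dinl_embedding M N) h = f /\
      @resM N (cm_union M N) dinr (@dinr_embedding M N) h = g;
  FW_disj : forall (M N M' N' : closed_manifold R n) (W : bordism M N)
    (W' : bordism M' N') (f : FW W) (g : FW W'),
    exists! h : FW (bordism_union W W'),
      resW (bordism_unionl_subbordism W W') h = f /\
      resW (bordism_unionr_subbordism W W') h = g;

  FW_glue_compat : forall (M N P : closed_manifold R n) (W' : bordism M N)
    (W'' : bordism N P) (W : bordism M P) (j' : W' -> W) (j'' : W'' -> W)
    (h : is_gluing j' j'') (f : FW W),
    resB (bout_embedding W') (resW (gluingl_subbordism h) f) =
    resB (bin_embedding W'') (resW (gluingr_subbordism h) f);
  FW_glue : forall (M N P : closed_manifold R n) (W' : bordism M N)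
    (W'' : bordism N P) (W : bordism M P) (j' : W' -> W) (j'' : W'' -> W)
    (h : is_gluing j' j'') (f' : FW W') (f'' : FW W''),
    resB (bout_embedding W') f' = resB (bin_embedding W'') f'' ->
    exists! f : FW W,
      resW (gluingl_subbordism h) f = f' /\
      resW (gluingr_subbordism h) f = f'' }.
Arguments FW {R n} F {M N} W : rename.
Arguments resM {R n} F {M0 M j} hj f : rename.
Arguments resW {R n} F {M0 N0 M N W0 W j} hj f : rename.
Arguments resB {R n} F {L M N W j} hj f : rename.
Arguments FM_disj {R n} F {M N} f g : rename.

Definition field_resl (R : realType) (n : nat) (F : field_system R n)
    (M N : closed_manifold R n) (f : F (cm_union M N)) : F M :=
  @resM R n F M (cm_union M N) dinl (@dinl_embedding M N) f.

Definition field_resr (R : realType) (n : nat) (F : field_system R n)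
    (M N : closed_manifold R n) (f : F (cm_union M N)) : F N :=
  @resM R n F N (cm_union M N) dinr (@dinr_embedding M N) f.

(* The inverse of the bijection [f |-> (field_resl f, field_resr f)]. *)
Definition field_pair (R : realType) (n : nat) (F : field_system R n)
    (M N : closed_manifold R n) (f : F M) (g : F N) : F (cm_union M N) :=
  projT1 (cid (FM_disj F f g)).

Record action_exponentials (R : realType) (n : nat) (F : field_system R n)
    (C : strict_monoidal_category) := ActionExponentials {
  TW : forall (M N : closed_manifold R n) (W : bordism M N), FW F W -> smor C;

  TW_empty : forall (M N : closed_manifold R n) (W : bordism M N) (f : FW F W),
    (W -> False) -> TW f = sid (sunit C);
  TW_disj : forall (M N M' N' : closed_manifold R n) (W : bordism M N)
    (W' : bordism M' N') (f : FW F (bordism_union W W')),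
    TW f = stensor (TW (resW F (bordism_unionl_subbordism W W') f))
                   (TW (resW F (bordism_unionr_subbordism W W') f));
  TW_glue : forall (M N P : closed_manifold R n) (W' : bordism M N)
    (W'' : bordism N P) (W : bordism M P) (j' : W' -> W) (j'' : W'' -> W)
    (h : is_gluing j' j'') (f : FW F W),
    let a := TW (resW F (gluingl_subbordism h) f) in
    let b := TW (resW F (gluingr_subbordism h) f) in
    scod a = sdom b /\ TW f = scomp b a;
  TW_homeo : forall (M N M' N' : closed_manifold R n) (W : bordism M N)
    (W' : bordism M' N') (phi : W -> W') (h : bordism_homeo phi) (f : FW F W'),
    TW (resW F (bordism_homeo_subbordism h) f) = TW f }.

(** * State modules, state sums and the projection *)

Definition isotopic_to_id (R : realType) (X : topologicalType) (phi : X -> X) :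
    Prop :=
  exists H : X * unit_interval R -> X,
    [/\ continuous H, forall t, homeomorphism (fun x => H (x, t)),
        forall x, H (x, i0 R) = x & forall x, H (x, i1 R) = phi x].

(* [is_state z] says that [z] belongs to the state module Z(M). *)
Definition is_state (R : realType) (n : nat) (F : field_system R n)
    (S : complete_semiring) (C : strict_monoidal_category)
    (M : closed_manifold R n) (z : F M -> Qmod S C) : Prop :=
  forall (phi : M -> M) (h : homeomorphism phi), isotopic_to_id R phi ->
    forall f : F M, z (resM F (homeomorphism_embedding h) f) = z f.

Definition state_sum (R : realType) (n : nat) (F : field_system R n)
    (S : complete_semiring) (C : strict_monoidal_category)
    (T : action_exponentials F C) (M N : closed_manifold R n)
    (W : bordism M N) (f : F (cm_union M N)) : Qmod S C :=
  Qsum (fun G : {G : FW F W | resB F (boundary_embedding W) G = f} =>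
          Qchar S (TW T (sval G))).

Definition contraction (S : complete_semiring) (C : strict_monoidal_category)
    (A B D : Type) (z : A -> B -> Qmod S C) (z' : B -> D -> Qmod S C)
    (f : A) (h : D) : Qmod S C :=
  Qsum (fun g : B => Qmul (z f g) (z' g h)).

(* The identifications between functions on F(M |_| N) and on F(M) x F(N). *)
Definition on_pairs (R : realType) (n : nat) (F : field_system R n)
    (A : Type) (M N : closed_manifold R n) (z : F (cm_union M N) -> A)
    (f : F M) (g : F N) : A := z (field_pair f g).

Definition on_union (R : realType) (n : nat) (F : field_system R n)
    (A : Type) (M N : closed_manifold R n) (z : F M -> F N -> A)
    (f : F (cm_union M N)) : A := z (field_resl f) (field_resr f).

Definition projection (R : realType) (n : nat) (F : field_system R n)
    (S : complete_semiring) (C : strict_monoidal_category)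
    (T : action_exponentials F C) (M N : closed_manifold R n)
    (z : F (cm_union M N) -> Qmod S C) : F (cm_union M N) -> Qmod S C :=
  on_union
    (contraction (on_pairs (@state_sum R n F S C T M M (cylinder M)))
                 (on_pairs z)).
Arguments state_sum {R n F} S {C} T {M N} W f.
Arguments projection {R n F S C} T {M N} z f.

(* Main.v *)
Require Import Defs.
From mathcomp Require Import all_boot all_order all_algebra.
From mathcomp Require Import all_classical all_reals topology normedtype.
From mathcomp Require Import ring lra.
Set Implicit Arguments.
Unset Strict Implicit.
Unset Printing Implicit Defensive.
Import Order.TTheory GRing.Theory Num.Theory numFieldNormedType.Exports.
Local Open Scope classical_set_scope.
Local Open Scope ring_scope.

(** Everything rests on one topological fact: gluing a cylinder to a bordism [W]
along its incoming (or outgoing) boundary gives [W] back, relative to the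
boundary.  Since a gluing is presented by embeddings of its two pieces, no
quotient space is needed: it suffices to find a collar [M * [0, 1] -> W] of the
boundary together with an embedding [W -> W] onto the complement of the
half-open collar.  These are [cylinder_gluing_in] and [cylinder_gluing_out].

Collars exist by a form of the argument of Brown and Connelly.  A collar is
allowed to have a variable thickness [lam : M -> R], with [0 <= lam].  In a
boundary chart, pushing the points inwards by a bump function gives a collar
whose thickness is positive near a given point ([local_collar]).  Two collars of
thickness [lam] and [mu] can be stacked, the second one being carried inside by
the push of the first, into a collar of thickness [lam + mu] ([is_collarD]).  By
compactness of the boundary some collar has positive thickness everywhere
([collar_exists]), and it is rescaled to thickness 1.

On the algebraic side, (FGLUE) and (TGLUE) say that the state sum of a gluing is
the contraction of the state sums of its pieces ([state_sum_glue]): a field on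
the glued bordism is a pair of fields that agree on the common boundary, and its
action is the composite of the two actions.  Together with the topological fact
this gives [Z_W = <Z_(M * [0, 1]), Z_W>], which is the first claim.  For [W] a
cylinder it says that [Z_(M * [0, 1])] is idempotent for the contraction, and as
contraction is associative ([contractionA]) the second claim follows.

That state sums are invariant under homeomorphisms isotopic to the identity, and
that the projection preserves such invariance, reduces to the cylinder: an
isotopy [H] from the identity to [a] sweeps out the self-homeomorphism
[(x, t) |-> (H (x, t), t)] of [M * [0, 1]], which is the identity at one end and
[a] at the other.  A homeomorphism of [M |_| N] isotopic to the identity
preserves both summands because the interval is connected
([isotopic_split]), so the two ends can be treated separately. *)

(** * Continuity *)

(** A chart inverse is only continuous within the half space; a push followed by
it is continuous because the push stays in the half space. *)
Lemma within_continuous_comp (X Y Z : topologicalType) (H : set Y)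
    (q : X -> Y) (g : Y -> Z) (x : X) :
  {for x, continuous q} -> {within H, continuous g} -> H (q x) ->
  (\forall z \near x, H (q z)) -> {for x, continuous (g \o q)}.
Proof.
move=> cq /subspace_continuousP cg Hqx nH A /(cg _ Hqx) nA.
have nAq : nbhs x (fun z => H (q z) -> A (g (q z))) by exact: cq nA.
have nAH : nbhs x ((fun z => H (q z) -> A (g (q z))) `&` (fun z => H (q z))).
  by apply: filterI; [exact: nAq|exact: nH].
by apply: filterS nAH => z [h /h].
Qed.

Lemma continuous_dist (R : realType) (E : normedModType R) (v0 : E) :
  continuous (fun v : E => `|v0 - v|).
Proof.
move=> v; apply: (@continuous_comp _ _ _ (fun v => v0 - v) (fun w => `|w|)).
  by apply: continuousB; [exact: cvg_cst|exact: cvg_id].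
exact: norm_continuous.
Qed.

Section RealValued.
Variables (R : realType) (T : topologicalType).
Implicit Types h k : T -> R.

Lemma continuous_addr h k :
  continuous h -> continuous k -> continuous (fun x => h x + k x).
Proof. by move=> c1 c2 x; exact: (continuousD (c1 x) (c2 x)). Qed.

Lemma continuous_mulr h k :
  continuous h -> continuous k -> continuous (fun x => h x * k x).
Proof. by move=> c1 c2 x; exact: (continuousM (c1 x) (c2 x)). Qed.

Lemma continuous_posr h : continuous h -> continuous (fun x => Num.max 0 (h x)).
Proof.
move=> c x; apply: (@continuous_max R T (fun=> 0) h); last exact: c.
exact: cvg_cst.
Qed.

Lemma continuous_minr h k :
  continuous h -> continuous k -> continuous (fun x => Num.min (h x) (k x)).
Proof. by move=> c1 c2 x; exact: (@continuous_min R T _ _ _ (c1 x) (c2 x)). Qed.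

Lemma continuous_divr (r : R) h :
  continuous h -> continuous (fun x => h x / r).
Proof.
by move=> c; apply: continuous_mulr => // x; exact: cvg_cst.
Qed.

Lemma continuous_subr (r : R) h : continuous h -> continuous (fun x => r - h x).
Proof. by move=> c x; apply: continuousB; [exact: cvg_cst|exact: c]. Qed.

End RealValued.

(** A function on [X] given by two formulas, on an open [U] and outside of a
closed subset [K] of [U], is continuous: the two open sets [U] and [~` K] cover
[X].  This extends constructions made in a chart by the identity. *)
Lemma continuous_patch (X Y : topologicalType) (U K : set X)
    (h h1 h2 : X -> Y) :
  open U -> closed K -> K `<=` U ->
  (forall x, U x -> {for x, continuous h1}) -> {in U, h1 =1 h} ->
  continuous h2 -> {in ~` K, h2 =1 h} -> continuous h.
Proof.
move=> oU cK KU c1 h1E c2 h2E x.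
have patch (O : set X) h' : open O -> O x -> {in O, h' =1 h} ->
    {for x, continuous h'} -> {for x, continuous h}.
  move=> oO Ox h'E c A; rewrite /= -h'E ?inE// => /c nA.
  have nO : nbhs x O by exact: open_nbhs_nbhs.
  have nAO : nbhs x ((h' @^-1` A) `&` O) by exact: filterI.
  by apply: filterS nAO => y [/= + Oy]; rewrite h'E// inE.
have [Ux|nUx] := pselect (U x).
  by apply: (patch U h1) => //; exact: c1.
apply: (patch (~` K) h2) => //; [exact: closed_openC|by move=> /KU|].
exact: c2.
Qed.

Lemma range_closed (X Y : topologicalType) (f : X -> Y) :
  compact [set: X] -> hausdorff_space Y -> continuous f -> closed (range f).
Proof.
move=> cX hY cf; apply: compact_closed => //.
by apply: continuous_compact => //; exact: continuous_subspaceT.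
Qed.

Lemma compact_hausdorff_homeo (X Y : topologicalType) (f : X -> Y) :
  compact [set: X] -> hausdorff_space Y -> continuous f -> injective f ->
  (forall y, exists x, f x = y) -> homeomorphism f.
Proof.
move=> cX hY cf fi /choice[g fg]; exists g; split=> //; last first.
  by move=> x; apply: fi; exact: fg.
apply/continuous_closedP => A cA.
have -> : g @^-1` A = f @` A.
  apply/seteqP; split=> [y Agy|_ [x Ax <-]]; first by exists (g y).
  by rewrite /preimage /= (_ : g (f x) = x)//; apply: fi; exact: fg.
apply: compact_closed => //; apply: continuous_compact.
  exact: continuous_subspaceT.
by apply: subclosed_compact cA cX _.
Qed.

(** * Collars of variable thickness *)

(** A collar of [b : M -> X] of thickness [lam]: [c] restricted to
[0 <= s <= lam x] is the collar itself and [e] pushes [X] off the part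
[s < lam x] of it.  So [X] is exhibited as the union of
[{(x, s) | 0 <= s <= lam x}] and a copy of [X], glued along the graph of [lam]
and the boundary.  Beyond the graph [c] is constant along the lines [{x} * R],
which makes it a total continuous function.  [B] is the rest of the boundary,
which is left alone. *)
Record is_collar (R : realType) (M X : topologicalType) (b : M -> X)
    (B : set X) (lam : M -> R) (c : M * R -> X) (e : X -> X) : Prop :=
  IsCollar {
    clr_thick_cont : continuous lam;
    clr_thick_ge0 : forall x, 0 <= lam x;
    clr_cont : continuous c;
    clr_emb : embedding e;
    clr_base : forall x, c (x, 0) = b x;
    clr_top : forall x s, lam x <= s -> c (x, s) = e (b x);
    clr_inj : forall x s x' s', 0 <= s <= lam x -> 0 <= s' <= lam x' ->
      c (x, s) = c (x', s') -> x = x' /\ s = s';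
    clr_meet : forall x s y, 0 <= s <= lam x -> c (x, s) = e y ->
      s = lam x /\ y = b x;
    clr_cover : forall y, (exists y', y = e y') \/
      exists x s, 0 <= s <= lam x /\ y = c (x, s);
    clr_fix : forall y, B y -> e y = y }.

Section Stacking.
Variables (R : realType) (M X : topologicalType) (b : M -> X) (B : set X).

Lemma is_collar0 : embedding b ->
  is_collar b B (fun=> 0 : R) (fun p => b p.1) id.
Proof.
move=> [cb bi]; split=> //.
- by move=> x; exact: cvg_cst.
- by move=> [x s]; apply: continuous_fst_comp; exact: cb.
- by split=> // x; exact: cvg_id.
- by move=> x s x' s' /le_anti <- /le_anti <- /bi.
- by move=> x s y /le_anti <- <-.
- by move=> y; left; exists y.
Qed.

(** Stacking: [X] is the union of the first collar and [e X], and inside [e X]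
sits the image under [e] of the second collar and of [e' X].  The line over [x]
first runs through the first collar up to [lam x], then through the second
one. *)
Lemma is_collarD (lam mu : M -> R) (c d : M * R -> X) (e e' : X -> X) :
  is_collar b B lam c e -> is_collar b B mu d e' ->
  is_collar b B (fun x => lam x + mu x)
    (fun p => if p.2 <= lam p.1 then c p else e (d (p.1, p.2 - lam p.1)))
    (e \o e').
Proof.
move=> C D; set c' := fun p : M * R => if _ then _ else _.
have [ce ei] := clr_emb C; have [ce' ei'] := clr_emb D.
have low x s : s <= lam x -> c' (x, s) = c (x, s) by rewrite /c' /= => ->.
have high x s : lam x <= s -> c' (x, s) = e (d (x, s - lam x)).
  rewrite /c' /= le_eqVlt => /orP[/eqP<-|/lt_geF-> //].
  by rewrite lexx (clr_top C)// subrr (clr_base D).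
split.
- by move=> x; apply: continuousD; [exact: (clr_thick_cont C)|
    exact: (clr_thick_cont D)].
- by move=> x; apply: addr_ge0; [exact: (clr_thick_ge0 C)|
    exact: (clr_thick_ge0 D)].
- have cl1 : continuous (fun p : M * R => lam p.1).
    by move=> [x s]; apply: continuous_fst_comp; exact: (clr_thick_cont C).
  have cs : continuous (fun p : M * R => p.2 : R) by move=> ?; exact: cvg_snd.
  have cd : continuous (fun p : M * R => p.2 - lam p.1).
    by move=> p; apply: continuousB; [exact: cs|exact: cl1].
  apply/continuous_subspace_setT.
  (* The two formulas agree on the graph of [lam], where both give [e (b x)]. *)
  have -> : [set: M * R] = [set p | p.2 - lam p.1 <= 0] `|`
      [set p | 0 <= p.2 - lam p.1].
    apply/seteqP; split=> // p _ /=.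
    by case: (leP (p.2 - lam p.1) 0) => [?|/ltW ?]; [left|right].
  apply: withinU_continuous.
  + apply: (@closed_comp _ R (fun p : M * R => p.2 - lam p.1)
      [set r | r <= 0]); [by move=> ? _; exact: cd|exact: closed_le].
  + apply: (@closed_comp _ R (fun p : M * R => p.2 - lam p.1)
      [set r | 0 <= r]); [by move=> ? _; exact: cd|exact: closed_ge].
  + apply: (subspace_eq_continuous (f := c)).
      by move=> [x s]; rewrite inE /= subr_le0 => h; exact: esym (low _ _ h).
    by apply: continuous_subspaceT; exact: (clr_cont C).
  + apply: (subspace_eq_continuous
      (f := fun p : M * R => e (d (p.1, p.2 - lam p.1)))).
      by move=> [x s]; rewrite inE /= subr_ge0 => h; exact: esym (high _ _ h).
    apply: continuous_subspaceT => p.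
    apply: (@continuous_comp _ _ _
      (fun p : M * R => d (p.1, p.2 - lam p.1)) e); last exact: ce.
    apply: (@continuous_comp _ _ _
      (fun p : M * R => (p.1, p.2 - lam p.1)) d); last exact: (clr_cont D).
    by apply: continuous_pair; [exact: cvg_fst|exact: cd].
- exact: embedding_comp (clr_emb D) (clr_emb C).
- by move=> x; rewrite low ?(clr_thick_ge0 C)// (clr_base C).
- move=> x s h; rewrite high /= ?(clr_top D)//.
    by rewrite lerBrDl.
  by apply: le_trans h; rewrite lerDl; exact: (clr_thick_ge0 D).
- have mixed x s x' s' : 0 <= s <= lam x -> lam x' <= s' <= lam x' + mu x' ->
      c (x, s) = e (d (x', s' - lam x')) -> x = x' /\ s = s'.
    move=> hs /andP[h1 h2] /(clr_meet C hs)[sE].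
    rewrite -(clr_base D) => /(clr_inj D)[||xx st].
    + by rewrite subr_ge0 h1 lerBlDl.
    + by rewrite lexx (clr_thick_ge0 D).
    + by move/eqP: st; rewrite subr_eq0 sE -xx => /eqP.
  move=> x s x' s' /andP[s0 sl] /andP[s0' sl'].
  have [h|/ltW h] := leP s (lam x); have [h'|/ltW h'] := leP s' (lam x').
  + by rewrite !low//; apply: (clr_inj C); rewrite ?s0 ?s0'.
  + by rewrite low// high//; apply: mixed; rewrite ?s0 ?h'.
  + rewrite high// low// => /esym h0.
    by have [||-> ->] := mixed _ _ _ _ _ _ h0; rewrite ?s0' ?h.
  + rewrite !high// => /ei/(clr_inj D)[||xx].
    * by rewrite subr_ge0 h lerBlDl.
    * by rewrite subr_ge0 h' lerBlDl.
    * by rewrite xx => /addIr.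
- move=> x s y /andP[s0 sl]; have [h|/ltW h] := leP s (lam x).
    rewrite low//= => /(clr_meet C)[]; first by rewrite s0.
    move=> -> /esym; rewrite -(clr_base D) => dy.
    have [|<- ->] := clr_meet D _ dy.
      by rewrite lexx (clr_thick_ge0 D).
    by rewrite addr0 (clr_base D).
  rewrite high//= => /ei/(clr_meet D)[]; first by rewrite subr_ge0 h lerBlDl.
  by move/eqP; rewrite subr_eq addrC => /eqP.
- move=> y; have [[y1 ->]|[x [s [/andP[s0 sl] ->]]]] := clr_cover C y.
    have [[y2 ->]|[x [s [/andP[s0 sl] ->]]]] := clr_cover D y1.
      by left; exists y2.
    right; exists x, (lam x + s); split.
      by rewrite addr_ge0 ?(clr_thick_ge0 C)//= lerD2l.
    by rewrite high ?lerDl// addrC addrA addNr add0r.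
  right; exists x, s; rewrite low// s0; split=> //=.
  by rewrite (le_trans sl)// lerDl (clr_thick_ge0 D).
- by move=> y By /=; rewrite (clr_fix D)// (clr_fix C).
Qed.

End Stacking.

(** * Collars inside one boundary chart *)

(** The one-dimensional push: an increasing piecewise linear bijection of the
line that moves 0 to [w], is the identity beyond [eps], and for [w <= eps / 2]
has slope at least 1/2. *)
Section Shear.
Variables (R : realType) (eps w : R).
Hypothesis eps0 : 0 < eps.
Hypothesis w0e : 0 <= w <= eps / 2.

Definition shear (t : R) : R := t + w * Num.max 0 (1 - t / eps).

Definition unshear (y : R) : R :=
  if y <= eps then (y - w) / (1 - w / eps) else y.

Let slope_gt0 : 0 < 1 - w / eps.
Proof.
have /andP[_ we] := w0e.
suff : w / eps <= 1 / 2 by lra.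
by rewrite ler_pdivrMr//; lra.
Qed.

Let shear_low t : t <= eps -> shear t = w + (1 - w / eps) * t.
Proof.
move=> te; rewrite /shear max_r; last first.
  by rewrite subr_ge0 ler_pdivrMr// mul1r.
by field; rewrite gt_eqF.
Qed.

Let slope_eps : w + (1 - w / eps) * eps = eps.
Proof. by field; rewrite gt_eqF. Qed.

Lemma shear_high t : eps <= t -> shear t = t.
Proof.
move=> te; rewrite /shear max_l ?mulr0 ?addr0// subr_le0.
by rewrite ler_pdivlMr// mul1r.
Qed.

Lemma unshear_high y : eps <= y -> unshear y = y.
Proof.
rewrite le_eqVlt /unshear => /orP[/eqP<-|/lt_geF-> //].
rewrite lexx; apply: (mulIf (lt0r_neq0 slope_gt0)).
by rewrite divfK ?gt_eqF// -[X in X - w = _]slope_eps; ring.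
Qed.

Lemma shear_le t : t <= eps -> shear t <= eps.
Proof.
by move=> te; rewrite shear_low// -[leRHS]slope_eps lerD2l ler_pM2l.
Qed.

Lemma unshear_le y : y <= eps -> unshear y <= eps.
Proof.
move=> ye; rewrite /unshear ye ler_pdivrMr// mulrC.
by have := slope_eps; lra.
Qed.

Lemma shearK : cancel shear unshear.
Proof.
move=> t; have [te|te] := leP t eps.
  rewrite /unshear shear_le// shear_low// addrAC subrr add0r mulrC mulKf//.
  by rewrite gt_eqF.
by rewrite shear_high ?unshear_high// ltW.
Qed.

Lemma unshearK : cancel unshear shear.
Proof.
move=> y; have [ye|ye] := leP y eps.
  rewrite shear_low ?unshear_le// /unshear ye mulrC divfK ?gt_eqF//.
  by ring.
by rewrite unshear_high ?shear_high// ltW.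
Qed.

Lemma unshear_incr : {homo unshear : x y / x <= y}.
Proof.
move=> x y xy; have [ye|/ltW ye] := leP y eps.
  have xe : x <= eps by lra.
  by rewrite /unshear xe ye ler_pM2r ?invr_gt0// lerD2r.
rewrite (unshear_high ye); have [xe|/ltW xe] := leP x eps.
  exact: le_trans (unshear_le xe) ye.
by rewrite unshear_high.
Qed.

Lemma shear_at0 : shear 0 = w.
Proof. by rewrite /shear mul0r subr0 (max_r ler01) add0r mulr1. Qed.

Lemma shear_ge0 t : 0 <= t -> 0 <= shear t.
Proof.
move=> t0; rewrite /shear addr_ge0// mulr_ge0//; first by case/andP: w0e.
by rewrite le_max lexx.
Qed.

Lemma unshear_ge0 y : w <= y -> 0 <= unshear y.
Proof. by move=> /unshear_incr; rewrite -shear_at0 shearK. Qed.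

Lemma shear_le_offset t : 0 <= t -> shear t <= w -> t = 0.
Proof.
move=> t0 /unshear_incr; rewrite -shear_at0 !shearK => tle.
by apply/eqP; rewrite eq_le tle.
Qed.

End Shear.

Lemma shear_offset0 (R : realType) (eps t : R) : shear eps 0 t = t.
Proof. by rewrite /shear mul0r addr0. Qed.

(** The chart [f], with inverse [g], identifies [U] with the open part [H] of
the half space; [b x0] goes to [(v0, 0)]. *)
Section LocalCollar.
Variables (R : realType) (n : nat) (M X : topologicalType) (b : M -> X).
Variables (B U : set X) (V : set ('rV[R]_n * R)).
Variables (f : X -> 'rV[R]_n * R) (g : 'rV[R]_n * R -> X) (x0 : M).
Hypothesis hausX : hausdorff_space X.
Hypothesis embb : embedding b.
Hypothesis closedB : closed B.
Hypothesis disjB : forall x, ~ B (b x).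
Hypothesis openU : open U.
Hypothesis Ux0 : U (b x0).
Hypothesis openV : open V.
Hypothesis chart : homeo_between U (V `&` @half_space R n) f g.
Hypothesis bdry : forall y, U y -> ((range b `|` B) y <-> (f y).2 = 0).

Local Notation H := (V `&` @half_space R n).
Local Notation v0 := (f (b x0)).1.

Lemma chart_boundary x : U (b x) -> f (b x) = ((f (b x)).1, 0).
Proof.
move=> Ux; have -> : 0 = (f (b x)).2 by apply/esym/bdry => //; left; exists x.
by case: (f (b x)).
Qed.

Definition box (eps : R) : set ('rV[R]_n * R) :=
  [set p | `|v0 - p.1| <= eps /\ 0 <= p.2 <= eps].

Lemma small_box : exists eps : R, 0 < eps /\
  forall p, box eps p -> H p /\ ~ B (g p).
Proof.
have [cf cg fg gf] := chart.
have [Hp0 gp0] := fg _ Ux0.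
have nB : nbhs (g (f (b x0))) (~` B).
  rewrite gp0; apply: open_nbhs_nbhs.
  by split; [exact: closed_openC|exact: disjB].
move/subspace_continuousP: cg => /(_ _ Hp0 _ nB) ngB.
have nV : nbhs (f (b x0)) V by apply: open_nbhs_nbhs; split=> //; case: Hp0.
have : nbhs (f (b x0)) (V `&` [set p | H p -> ~ B (g p)]).
  by apply: filterI => //; exact: ngB.
move=> /nbhs_ballP[e /= e0 eb]; exists (e / 2); split; first by lra.
move=> [v t] [/= vle /andP[t0 te]].
have [|Vp hp] := eb (v, t).
  rewrite chart_boundary//; split=> /=.
    by rewrite -ball_normE /=; lra.
  by rewrite -ball_normE /= sub0r normrN ger0_norm; lra.
by have Hp : H (v, t) by []; split=> //; exact: hp.
Qed.

Variable eps : R.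
Hypothesis eps0 : 0 < eps.
Hypothesis eps_box : forall p, box eps p -> H p /\ ~ B (g p).

Definition bump (v : 'rV[R]_n) : R := Num.max 0 (eps - `|v0 - v|) / 2.

Lemma bump_itv v : 0 <= bump v <= eps / 2.
Proof.
rewrite /bump; move: `|v0 - v| (normr_ge0 (v0 - v)) => d d0.
case: (leP 0 (eps - d)) => ?; last by rewrite mul0r lexx divr_ge0// ltW.
by rewrite divr_ge0//= ler_pM2r ?invr_gt0// lerBlDr lerDl.
Qed.

Lemma bump_neq0 v : bump v != 0 -> `|v0 - v| <= eps.
Proof.
rewrite /bump; case: (leP 0 (eps - _)); last by rewrite mul0r eqxx.
by rewrite subr_ge0.
Qed.

Lemma continuous_bump : continuous bump.
Proof.
apply: continuous_divr; apply: continuous_posr; apply: continuous_subr.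
exact: continuous_dist.
Qed.

(** Moving vertically inside the box, where the bump is supported, does not
leave the image of the chart. *)
Lemma chart_vertical v t t' : H (v, t) -> 0 <= t' ->
  (bump v = 0 -> t' = t) -> (eps <= t -> t' = t) -> (t <= eps -> t' <= eps) ->
  H (v, t').
Proof.
move=> Hvt t0 b0 hi lo; have [et|/ltW te] := leP eps t; first by rewrite hi.
have [/b0 -> //|/bump_neq0 vb] := eqVneq (bump v) 0.
by apply: (eps_box (p := (v, t')) _).1; split; rewrite /= ?vb// t0 lo.
Qed.

Definition offset v (s : R) : R := Num.min (bump v) (Num.max 0 s).

Lemma offset_itv v s : 0 <= offset v s <= eps / 2.
Proof.
have /andP[b0 be] := bump_itv v.
by rewrite /offset le_min b0 le_max lexx /= (le_trans _ be)// ge_min lexx.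
Qed.

Lemma offset_bump0 v s : bump v = 0 -> offset v s = 0.
Proof. by move=> b0; rewrite /offset b0 min_l// le_max lexx. Qed.

Definition vshift (p : 'rV[R]_n * R) (s : R) : 'rV[R]_n * R :=
  (p.1, shear eps (offset p.1 s) p.2).

(** The push by the amount [s], carried to [X] by the chart.  The argument [s]
traces the collar lines, and the value at [s = eps], where [offset] has reached
the full height of the bump, is the embedding of the collar. *)
Definition push (y : X) (s : R) : X :=
  if `[< U y >] then g (vshift (f y) s) else y.

Lemma chart_vshift p s : H p -> H (vshift p s).
Proof.
case: p => v t Hp; apply: (chart_vertical Hp) => /=.
- by apply: shear_ge0; [exact: offset_itv|case: Hp].
- by move=> /offset_bump0 ->; rewrite shear_offset0.
- exact: shear_high.
- by apply: shear_le => //; exact: offset_itv.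
Qed.

Lemma continuous_vshift :
  continuous (fun q : ('rV[R]_n * R) * R => vshift q.1 q.2).
Proof.
have c1 : continuous (fun q : ('rV[R]_n * R) * R => q.1.1).
  by move=> q; apply: (continuous_fst_comp (h := fst)); exact: cvg_fst.
have c2 : continuous (fun q : ('rV[R]_n * R) * R => q.1.2).
  by move=> q; apply: (continuous_fst_comp (h := snd)); exact: cvg_snd.
have c3 : continuous (fun q : ('rV[R]_n * R) * R => q.2).
  by move=> q; exact: cvg_snd.
have c4 : continuous (fun q : ('rV[R]_n * R) * R => bump q.1.1).
  by move=> q; exact: (continuous_comp (c1 q) (@continuous_bump q.1.1)).
move=> q; apply: (@continuous_pair _ _ _
  (fun q : ('rV[R]_n * R) * R => q.1.1)
  (fun q : ('rV[R]_n * R) * R => shear eps (offset q.1.1 q.2) q.1.2)).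
  exact: c1.
apply: (continuous_addr c2); apply: continuous_mulr.
  exact: continuous_minr c4 (continuous_posr c3).
by apply: continuous_posr; apply: continuous_subr; apply: continuous_divr.
Qed.

Lemma chart_coords y : U y -> H (f y) /\ g (f y) = y.
Proof. by have [_ _ + _] := chart; apply. Qed.

Lemma push_in y s : U y ->
  U (push y s) /\ f (push y s) = vshift (f y) s.
Proof.
move=> Uy; have [_ _ _ gf] := chart; rewrite /push asboolT//.
by apply/gf/chart_vshift; case: (chart_coords Uy).
Qed.

Lemma push_out y s : ~ U y -> push y s = y.
Proof. by move=> nUy; rewrite /push asboolF. Qed.

Lemma box_compact : compact (box eps).
Proof.
have -> : box eps = [set v | `|v0 - v| <= eps] `*` [set` `[0, eps]].
  by apply/seteqP; split=> -[v t]; rewrite /box /= in_itv.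
apply: compact_setX; last exact: segment_compact.
apply: bounded_closed_compact.
  exists (`|v0| + eps); split; first by rewrite num_real.
  move=> r rlt v /= vle; apply: le_trans (ltW rlt).
  by rewrite -[v](subKr v0) (le_trans (ler_normB _ _))// lerD2l.
apply: (@closed_comp 'rV[R]_n R (fun v => `|v0 - v|) [set r | r <= eps]).
  by move=> v _; exact: continuous_dist.
exact: closed_le.
Qed.

Lemma core_closed : closed (g @` box eps).
Proof.
apply: compact_closed => //; apply: continuous_compact box_compact.
have [_ cg _ _] := chart; apply: continuous_subspaceW cg.
by move=> p /eps_box[].
Qed.

Lemma core_sub : g @` box eps `<=` U.
Proof.
by move=> _ [p /eps_box[Hp _] <-]; have [_ _ _ /(_ _ Hp)[]] := chart.
Qed.

(** The push is supported in the compact image of the box: elsewhere either the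
bump vanishes or the height exceeds [eps]. *)
Lemma push_outside_core y s : ~ (g @` box eps) y -> push y s = y.
Proof.
move=> nK; have [Uy|/push_out //] := pselect (U y).
have [[Vy Hy] gfy] := chart_coords Uy.
rewrite /push asboolT// -[RHS]gfy; congr g.
rewrite /vshift [RHS]surjective_pairing; congr pair.
have [b0|b0] := eqVneq (bump (f y).1) 0.
  by rewrite offset_bump0// shear_offset0.
apply: shear_high => //; rewrite leNgt; apply/negP => /ltW lt.
apply: nK; exists (f y) => //; split; first exact: bump_neq0.
by rewrite lt andbT.
Qed.

Lemma continuous_push : continuous (fun q : X * R => push q.1 q.2).
Proof.
have [cf cg fg gf] := chart.
apply: (@continuous_patch _ _ [set q : X * R | U q.1]
  [set q : X * R | (g @` box eps) q.1] _
  (g \o (fun q : X * R => vshift (f q.1) q.2)) fst).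
- by apply: (@open_comp _ _ fst U) => // ? _; exact: cvg_fst.
- apply: (@closed_comp _ _ fst (g @` box eps)); last exact: core_closed.
  by move=> ? _; exact: cvg_fst.
- by move=> q; exact: core_sub.
- move=> [y s] /= Uy; apply: within_continuous_comp cg _ _.
  + apply: (@continuous_comp _ _ _ (fun q : X * R => (f q.1, q.2))
      (fun q => vshift q.1 q.2)); last exact: continuous_vshift.
    apply: continuous_pair; last exact: cvg_snd.
    apply: continuous_fst_comp.
    by move: cf; rewrite continuous_open_subspace//; apply; rewrite inE.
  + by apply: chart_vshift; case: (chart_coords Uy).
  + have : nbhs (y, s) [set q : X * R | U q.1].
      apply: open_nbhs_nbhs; split=> //.
      by apply: (@open_comp _ _ fst U) => // ? _; exact: cvg_fst.
    by apply: filterS => q Uq; apply: chart_vshift; case: (chart_coords Uq).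
- by move=> [y s]; rewrite inE /= => Uy; rewrite /push asboolT.
- by move=> ?; exact: cvg_fst.
- by move=> [y s]; rewrite inE /= => nK; rewrite push_outside_core.
Qed.

Definition thickness (x : M) : R :=
  if `[< U (b x) >] then bump (f (b x)).1 else 0.

Lemma thickness_in x : U (b x) -> thickness x = bump (f (b x)).1.
Proof. by move=> Ux; rewrite /thickness asboolT. Qed.

Lemma thickness_out x : ~ U (b x) -> thickness x = 0.
Proof. by move=> Ux; rewrite /thickness asboolF. Qed.

Lemma continuous_thickness : continuous thickness.
Proof.
have [cb _] := embb; have [cf _ _ _] := chart.
apply: (@continuous_patch _ _ (b @^-1` U) (b @^-1` (g @` box eps)) _
  (fun x => bump (f (b x)).1) (fun=> 0)).
- by apply: open_comp => // x _; exact: cb.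
- by apply: closed_comp; [move=> x _; exact: cb|exact: core_closed].
- by move=> x; exact: core_sub.
- move=> x Ux; have cfx : {for b x, continuous f}.
    by move: cf; rewrite continuous_open_subspace//; apply; rewrite inE.
  have cfb : {for x, continuous (f \o b)} := continuous_comp (cb x) cfx.
  have c1 : {for x, continuous (fun x => (f (b x)).1)}.
    by apply: (continuous_comp cfb); exact: cvg_fst.
  exact: (continuous_comp c1 (@continuous_bump _)).
- by move=> x; rewrite inE => Ux; rewrite thickness_in.
- by move=> x; exact: cvg_cst.
- move=> x; rewrite inE => nK; have [Ux|Ux] := pselect (U (b x)); last first.
    by rewrite thickness_out.
  rewrite thickness_in//; apply/eqP; rewrite eq_sym.
  apply/negPn/negP => /bump_neq0 vle; apply: nK; exists (f (b x)).
    by rewrite chart_boundary//; split; rewrite //= lexx ltW.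
  by case: (chart_coords Ux).
Qed.

Lemma offset_le v s : 0 <= s <= bump v -> offset v s = s.
Proof. by move=> /andP[s0 sb]; rewrite /offset max_r// min_r. Qed.

Lemma offset_ge v s : bump v <= s -> offset v s = bump v.
Proof. by move=> sb; rewrite /offset min_l// le_max sb orbT. Qed.

Lemma offset_eps v : offset v eps = bump v.
Proof.
apply: offset_ge; have /andP[_ h] := bump_itv v; apply: le_trans h _.
by rewrite ler_pdivrMr// ler_peMr ?ltW// ltr1n.
Qed.

Lemma push_U y s : U (push y s) <-> U y.
Proof.
split=> [Up|/(push_in s)[]//].
by apply: contrapT => nU; move: Up; rewrite push_out.
Qed.

Lemma chart_inj y y' : U y -> U y' -> f y = f y' -> y = y'.
Proof.
by move=> /chart_coords[_ {2}<-] /chart_coords[_ {2}<-] ->.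
Qed.

Lemma push_boundary x s : U (b x) ->
  f (push (b x) s) = ((f (b x)).1, offset (f (b x)).1 s).
Proof.
move=> Ux; have [_ ->] := push_in s Ux; rewrite /vshift.
by rewrite [X in X.2]chart_boundary//= shear_at0.
Qed.

Lemma push_inj s : injective (push^~ s).
Proof.
move=> y y' yy'; have [Uy|nU] := pselect (U y).
  have Uy' : U y' by apply/(push_U y' s); rewrite -yy'; exact/push_U.
  have [_ fy] := push_in s Uy; have [_] := push_in s Uy'.
  rewrite -yy' fy /vshift => -[v1]; rewrite v1.
  move=> /(can_inj (shearK eps0 (offset_itv _ _))) t1.
  apply: chart_inj => //; apply/eqP.
  by rewrite -pair_eqE /pair_eq /= v1 t1 !eqxx.
have nU' : ~ U y'.
  by move=> Uy'; apply/nU/(push_U y s); rewrite yy'; exact/push_U.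
by move: yy'; rewrite !push_out.
Qed.

(** In the chart the collar is the region [0 <= t <= bump v] under the graph of
the bump, and [push^~ eps] maps the half space onto the region above it. *)
Lemma local_collar :
  is_collar b B thickness (fun p => push (b p.1) p.2) (push^~ eps).
Proof.
have [cb bi] := embb; have [cf cg fg gf] := chart.
have b2 v : 0 <= bump v <= eps / 2 := bump_itv v.
split=> /=.
- exact: continuous_thickness.
- move=> x; rewrite /thickness; case: ifP => // _.
  by case/andP: (b2 (f (b x)).1).
- move=> p; apply: (@continuous_comp _ _ _ (fun p : M * R => (b p.1, p.2))
    (fun q : X * R => push q.1 q.2)); last exact: continuous_push.
  apply: continuous_pair; last exact: cvg_snd.
  by apply: continuous_fst_comp; exact: cb.
- split; last exact: push_inj.
  move=> y; apply: (@continuous_comp _ _ _ (fun y : X => (y, eps))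
    (fun q : X * R => push q.1 q.2)); last exact: continuous_push.
  by apply: continuous_pair; [exact: cvg_id|exact: cvg_cst].
- move=> x; have [Ux|/push_out //] := pselect (U (b x)).
  apply: chart_inj => //; first by case: (push_in 0 Ux).
  rewrite push_boundary// [RHS]chart_boundary//; congr pair.
  by apply: offset_le; rewrite lexx; case/andP: (b2 (f (b x)).1).
- move=> x s; have [Ux|nU] := pselect (U (b x)); last by rewrite !push_out.
  rewrite thickness_in// => sb; rewrite /push; congr (if _ then g _ else _).
  by rewrite /vshift offset_ge// offset_eps.
- move=> x s x' s' hs hs' E.
  have [Ux|nU] := pselect (U (b x)).
    have Ux' : U (b x') by apply/(push_U _ s'); rewrite -E; exact/push_U.
    move: hs hs'; rewrite !thickness_in// => hs hs'.
    have := congr1 f E; rewrite !push_boundary// => -[v1].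
    rewrite !offset_le// => ss; split=> //; apply: bi; apply: chart_inj => //.
    by rewrite chart_boundary// [RHS]chart_boundary// v1.
  have nU' : ~ U (b x').
    by move=> Ux'; apply/nU/(push_U _ s); rewrite E; exact/push_U.
  move: hs hs'; rewrite !thickness_out// => /le_anti <- /le_anti <-; split=> //.
  by apply: bi; move: E; rewrite !push_out.
- move=> x s y hs E.
  have [Ux|nU] := pselect (U (b x)).
    have Uy : U y by apply/(push_U _ eps); rewrite -E; exact/push_U.
    move: hs; rewrite !thickness_in// => hs.
    have := congr1 f E; rewrite push_boundary// (push_in eps Uy).2 => -[v1 s1].
    rewrite offset_le// offset_eps in s1.
    have [[_ y0] _] := chart_coords Uy.
    have fy2 : (f y).2 = 0.
      apply: (shear_le_offset eps0 (b2 (f y).1) y0).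
      by rewrite -s1 -v1; case/andP: hs.
    split; first by rewrite s1 fy2 shear_at0 v1.
    apply: chart_inj => //; rewrite chart_boundary// v1 -fy2.
    by case: (f y).
  have nUy : ~ U y.
    by move=> Uy; apply/nU/(push_U _ s); rewrite E; exact/push_U.
  by move: hs E; rewrite !thickness_out// => /le_anti <-; rewrite !push_out.
- move=> y; have [Uy|nU] := pselect (U y); last first.
    by left; exists y; rewrite push_out.
  have [Hy gfy] := chart_coords Uy; have [_ y0] := Hy.
  have [tb|bt] := ltP (f y).2 (bump (f y).1).
    have vb : `|v0 - (f y).1| <= eps.
      by apply: bump_neq0; rewrite gt_eqF// (le_lt_trans y0).
    have box0 : box eps ((f y).1, 0) by split; rewrite //= lexx ltW.
    have [H0 nB] := eps_box box0.
    have [Ug fgE] := gf _ H0.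
    have [[x _ bx]|//] : (range b `|` B) (g ((f y).1, 0)).
      by apply/(bdry Ug); rewrite fgE.
    right; exists x, (f y).2; rewrite thickness_in bx// fgE /=.
    split; first by rewrite (y0 : 0 <= _) ltW.
    apply: chart_inj => //; first by case: (push_in (f y).2 Ug).
    rewrite (push_in _ Ug).2 fgE /vshift /= shear_at0 offset_le; last first.
      by rewrite (y0 : 0 <= _) ltW.
    by case: (f y).
  left; pose y' := g ((f y).1, unshear eps (bump (f y).1) (f y).2).
  have Hy' : H ((f y).1, unshear eps (bump (f y).1) (f y).2).
    have b1 := b2 (f y).1.
    apply: (@chart_vertical _ (f y).2).
    - by case: (f y) Hy.
    - exact: unshear_ge0.
    - by move=> b0; rewrite -[RHS](unshearK eps0 b1) b0 shear_offset0.
    - exact: unshear_high.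
    - exact: unshear_le.
  exists y'; have [Uy' fy'] := gf _ Hy'.
  apply: chart_inj => //; first by case: (push_in eps Uy').
  rewrite (push_in eps Uy').2 fy' /vshift /= offset_eps unshearK//.
  by case: (f y).
- move=> y By; have [Uy|/push_out //] := pselect (U y).
  apply: push_outside_core => -[p /eps_box[_ nB] gp].
  by apply: nB; rewrite gp.
Qed.

Lemma thickness_gt0 : 0 < thickness x0.
Proof.
by rewrite thickness_in// /bump subrr normr0 subr0 max_r ?divr_gt0// ltW.
Qed.

End LocalCollar.

(** * Collars of the whole boundary; gluing a cylinder to a bordism *)

Lemma collar_at (R : realType) (n : nat) (M X : topologicalType) (b : M -> X)
    (B : set X) (x0 : M) :
  hausdorff_space X -> embedding b -> closed B -> (forall x, ~ B (b x)) ->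
  @manifold_with_boundary R n X (range b `|` B) ->
  exists (lam : M -> R) c e, is_collar b B lam c e /\ 0 < lam x0.
Proof.
move=> hX eb cB disjB mX.
have [U [V [f [g [[oU Ux0] oV chart bdry]]]]] := mX (b x0).
have [eps [eps0 eps_box]] := small_box cB disjB Ux0 oV chart bdry.
do 3 eexists; split.
  exact: (local_collar hX eb oU chart bdry eps0 eps_box).
exact: thickness_gt0.
Qed.

(** The zero sets of thickness functions of collars are closed under
intersection, by stacking.  If none were empty they would generate a proper
filter; a cluster point of it contradicts the existence of a collar that is
thick at that point. *)
Lemma collar_exists (R : realType) (n : nat) (M X : topologicalType)
    (b : M -> X) (B : set X) :
  compact [set: M] -> hausdorff_space X -> embedding b -> closed B ->
  (forall x, ~ B (b x)) -> @manifold_with_boundary R n X (range b `|` B) ->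
  exists (lam : M -> R) c e, is_collar b B lam c e /\ forall x, 0 < lam x.
Proof.
move=> cM hX eb cB disjB mX; apply: contrapT => none.
pose thick := [set lam : M -> R | exists c e, is_collar b B lam c e].
pose F := filter_from thick (fun lam => [set x | lam x <= 0]).
have FF : ProperFilter F.
  apply: filter_from_proper.
    apply: filter_from_filter.
      by exists (fun=> 0), (fun p => b p.1), id; exact: is_collar0.
    move=> lam mu [c [e C]] [d [e' D]].
    exists (fun x => lam x + mu x).
      by do 2 eexists; exact: is_collarD C D.
    move=> x /= le0; have l0 := clr_thick_ge0 C x; have m0 := clr_thick_ge0 D x.
    by split=> /=; apply: le_trans le0; rewrite ?lerDl ?lerDr.
  move=> lam [c [e C]]; apply: contrapT => empty; apply: none.
  exists lam, c, e; split=> // x; rewrite ltNge; apply/negP => le0.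
  by apply: empty; exists x.
have [x0 [_ clx0]] := cM F FF filterT.
have [lam [c [e [C lam0]]]] := collar_at x0 hX eb cB disjB mX.
have : nbhs x0 [set x | 0 < lam x].
  apply: open_nbhs_nbhs; split=> //.
  apply: (@open_comp _ R lam [set r | 0 < r]); last exact: open_gt.
  by move=> x _; exact: (clr_thick_cont C).
have FZ : F [set x | lam x <= 0] by exists lam => //; exists c, e.
by move=> /(clx0 _ _ FZ)[x [/= /le_gtF ->]].
Qed.

(** Rescaling the lines of a collar of positive thickness to unit length. *)
Section UnitCollar.
Variables (R : realType) (M X : topologicalType) (b : M -> X) (B : set X).
Variables (lam : M -> R) (c : M * R -> X) (e : X -> X).
Hypothesis C : is_collar b B lam c e.
Hypothesis lam_gt0 : forall x, 0 < lam x.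

Definition collar_map (p : M * unit_interval R) : X :=
  c (p.1, val p.2 * lam p.1).

Let itv x (t : unit_interval R) : 0 <= val t * lam x <= lam x.
Proof.
have /andP[t0 t1] := val_unit_interval t; have l0 := lam_gt0 x.
by apply/andP; split; [rewrite mulr_ge0// ltW|rewrite ler_piMl// ltW].
Qed.

Lemma collar_map_embedding : embedding collar_map.
Proof.
split.
  move=> p; apply: (@continuous_comp _ _ _
    (fun p : M * unit_interval R => (p.1, val p.2 * lam p.1)) c);
    last exact: (clr_cont C).
  apply: (@continuous_pair _ _ _ (fun p : M * unit_interval R => p.1)
    (fun p => val p.2 * lam p.1)); first exact: cvg_fst.
  apply: (@continuous_mulr _ _ (fun p : M * unit_interval R => val p.2)
    (fun p => lam p.1)) => q.
    by apply: continuous_snd_comp; exact: val_continuous.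
  by apply: continuous_fst_comp; exact: (clr_thick_cont C).
move=> [x t] [x' t'] /(clr_inj C (itv _ _) (itv _ _))/=[xx].
by rewrite xx => /(mulIf (lt0r_neq0 (lam_gt0 x')))/val_inj ->.
Qed.

Lemma collar_map0 x : collar_map (x, i0 R) = b x.
Proof. by rewrite /collar_map /= mul0r (clr_base C). Qed.

Lemma collar_map1 x : collar_map (x, i1 R) = e (b x).
Proof. by rewrite /collar_map /= mul1r (clr_top C). Qed.

Lemma collar_map_meet p y :
  collar_map p = e y <-> exists x, p = (x, i1 R) /\ y = b x.
Proof.
split=> [|[x [-> ->]]]; last exact: collar_map1.
case: p => x t /(clr_meet C (itv _ _))[/= tl ->]; exists x; split=> //.
congr pair; apply: val_inj => /=; apply: (mulIf (lt0r_neq0 (lam_gt0 x))).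
by rewrite tl mul1r.
Qed.

Lemma collar_map_cover : range collar_map `|` range e = setT.
Proof.
apply/seteqP; split=> // y _.
have [[y' ->]|[x [s [/andP[s0 sl] ->]]]] := clr_cover C y.
  by right; exists y'.
have l0 := lam_gt0 x; left; exists (x, clamp (s / lam x)) => //.
rewrite /collar_map; congr (c (x, _)).
rewrite val_clamp ?divfK ?gt_eqF//.
by apply/andP; split; [rewrite divr_ge0// ltW|rewrite ler_pdivrMr// mul1r].
Qed.

End UnitCollar.

Definition interval_flip (R : realType) (t : unit_interval R) :
  unit_interval R := clamp (1 - val t).

Lemma val_flip (R : realType) (t : unit_interval R) :
  val (interval_flip t) = 1 - val t.
Proof.
apply: val_clamp; have /andP[t0 t1] := val_unit_interval t.
by rewrite subr_ge0 t1 gerBl.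
Qed.

Lemma flipK (R : realType) : involutive (@interval_flip R).
Proof. by move=> t; apply: val_inj; rewrite !val_flip subKr. Qed.

Lemma flip0 (R : realType) : interval_flip (i0 R) = i1 R.
Proof. by apply: val_inj; rewrite val_flip /= subr0. Qed.

Lemma flip1 (R : realType) : interval_flip (i1 R) = i0 R.
Proof. by apply: val_inj; rewrite val_flip /= subrr. Qed.

Lemma flip_continuous (R : realType) : continuous (@interval_flip R).
Proof.
have c1 : continuous (fun t : unit_interval R => 1 - val t).
  exact: (continuous_subr (@val_continuous R)).
by move=> t; exact: (continuous_comp (c1 t) (@clamp_continuous R _)).
Qed.

Section CollarGluing.
Variables (R : realType) (n : nat) (M N : closed_manifold R n).
Variable W : bordism M N.

(** The collar of the incoming boundary is a cylinder, and the push is an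
embedding of [W] in itself whose image is the rest of [W]. *)
Lemma cylinder_gluing_in : exists (j' : cylinder M -> W) (j'' : W -> W),
  @is_gluing R n M M N (cylinder M) W W j' j''.
Proof.
have closed_out : closed (range (bout W)).
  apply: range_closed; [exact: cm_compact|exact: bd_hausdorff|].
  by case: (bout_embedding W).
have disj x : ~ range (bout W) (bin W x) by move=> [y _ /esym]; exact: bin_bout.
have [lam [c [e [C l0]]]] := collar_exists (cm_compact M)
  (@bd_hausdorff _ _ _ _ W) (bin_embedding W) closed_out disj (bd_charts W).
exists (collar_map lam c), e; split.
- split; [exact: (collar_map_embedding C l0)|exact: clr_emb C|].
  exact: (collar_map_cover C l0).
- by move=> p y; rewrite (collar_map_meet C l0).
- by apply/funext => x; rewrite /= /cyl_in (collar_map0 C).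
- by apply/funext => y; rewrite /= (clr_fix C)//; exists y.
Qed.

(** The same for the outgoing boundary; the collar is traversed backwards, since
its outer end is now the outgoing end of the cylinder. *)
Lemma cylinder_gluing_out : exists (j' : W -> W) (j'' : cylinder N -> W),
  @is_gluing R n M N N W (cylinder N) W j' j''.
Proof.
have closed_in : closed (range (bin W)).
  apply: range_closed; [exact: cm_compact|exact: bd_hausdorff|].
  by case: (bin_embedding W).
have disj x : ~ range (bin W) (bout W x) by move=> [y _]; exact: bin_bout.
have charts := bd_charts W; rewrite setUC in charts.
have [lam [c [e [C l0]]]] := collar_exists (cm_compact N)
  (@bd_hausdorff _ _ _ _ W) (bout_embedding W) closed_in disj charts.
(* Reverses the collar so that time increases towards the boundary. *)
pose flip (p : N * unit_interval R) := (p.1, interval_flip p.2).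
have flipfK : involutive flip by move=> [x t]; rewrite /flip /= flipK.
have eflip : embedding flip.
  split; last exact: inv_inj.
  move=> p; apply: (@continuous_pair _ _ _ (fun p : N * unit_interval R => p.1)
    (fun p => interval_flip p.2)); first exact: cvg_fst.
  by apply: continuous_snd_comp; exact: flip_continuous.
exists e, (collar_map lam c \o flip); split.
- split; [exact: clr_emb C| |].
    exact: embedding_comp eflip (collar_map_embedding C l0).
  apply: etrans (collar_map_cover C l0); rewrite setUC; congr setU.
  apply/seteqP; split=> _ [p _ <-]; first by exists (flip p).
  by exists (flip p) => //=; rewrite flipfK.
- move=> y p; split=> [/esym/(collar_map_meet C l0)[x [px ->]]|[x [-> ->]]].
    exists x; split=> //; rewrite -[p]flipfK px.
    by rewrite /flip /cyl_in /= flip1.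
  by rewrite /flip /= flip0 (collar_map1 C).
- by apply/funext => y; rewrite /= (clr_fix C)//; exists y.
- by apply/funext => x; rewrite /= /cyl_out /flip /= flip1 (collar_map0 C).
Qed.

End CollarGluing.

(** * Sums in complete semirings and the composition semiring *)

Section Sums.
Variable S : complete_semiring.

Lemma eq_csum (I : Type) (m m' : I -> S) : m =1 m' -> csum S m = csum S m'.
Proof. by move=> /funext ->. Qed.

(** An absorbing zero and the distributive law for infinite sums make a sum of
zeros vanish. *)
Lemma csum_zero (I : Type) (m : I -> S) : (forall i, m i = 0) -> csum S m = 0.
Proof.
move=> m0; rewrite -[RHS](mul0r (csum S m)) -csumMl.
by apply: eq_csum => i; rewrite mul0r m0.
Qed.

Lemma csum_reindex (I J : Type) (p : I -> J) (m : J -> S) :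
  injective p -> (forall j, exists i, p i = j) ->
  csum S (fun i => m (p i)) = csum S m.
Proof.
move=> pinj psurj; rewrite -(csum_partition p); apply: eq_csum => j.
have [i pij] := psurj j.
rewrite (@csum1 _ _ _ (exist _ i pij)) /= ?pij// => -[i' pi'j].
by apply/eq_exist/pinj; rewrite pij.
Qed.

Lemma csum_single (I : Type) (m : I -> S) (a : I) :
  (forall i, i <> a -> m i = 0) -> csum S m = m a.
Proof.
move=> m0; rewrite -(csum_partition (fun i => `[< i = a >])).
rewrite (@csum2 _ _ _ true false)//; last by case; [left|right].
rewrite [X in _ + X]csum_zero; last first.
  by move=> [i /= /asboolPn]; exact: m0.
rewrite addr0 (@csum1 _ _ _ (exist _ a (asboolT erefl)))//.
by move=> [i ia]; apply: eq_exist; exact/asboolP.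
Qed.

(** Nested sums over subtypes are sums over a subtype of the product: partition
the latter by the first component. *)
Lemma csum_subtype_nest (I J : Type) (P : I -> Prop) (Q : I -> J -> Prop)
    (m : I -> J -> S) :
  csum S (fun i : {i | P i} =>
    csum S (fun j : {j | Q (sval i) j} => m (sval i) (sval j))) =
  csum S (fun t : {t : I * J | P t.1 /\ Q t.1 t.2} =>
    m (sval t).1 (sval t).2).
Proof.
pose p (t : {t : I * J | P t.1 /\ Q t.1 t.2}) : {i | P i} :=
  exist _ (sval t).1 (proj2_sig t).1.
rewrite -(csum_partition p); apply: eq_csum => -[i Pi] /=.
pose q (j : {j | Q i j}) : {t | p t = exist _ i Pi} :=
  exist _ (exist _ (i, sval j) (conj Pi (proj2_sig j))) (eq_exist _ _ erefl).
rewrite -(csum_reindex (p := q))//.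
  move=> [j Qj] [j' Qj'] /(congr1 (fun u => (sval (sval u)).2))/= jj.
  exact: eq_exist.
move=> [[[i' j] [Pi' Qj]] tE]; have /= ii := congr1 sval tE; subst i'.
by exists (exist _ j Qj); do 2 apply: eq_exist.
Qed.

Lemma csum_nest (I J : Type) (Q : I -> J -> Prop) (m : I -> J -> S) :
  csum S (fun i => csum S (fun j : {j | Q i j} => m i (sval j))) =
  csum S (fun t : {t : I * J | Q t.1 t.2} => m (sval t).1 (sval t).2).
Proof.
rewrite -(csum_partition (fun t : {t : I * J | Q t.1 t.2} => (sval t).1)).
apply: eq_csum => i.
pose q (j : {j | Q i j}) : {t : {t : I * J | Q t.1 t.2} | (sval t).1 = i} :=
  exist _ (exist _ (i, sval j) (proj2_sig j)) erefl.
rewrite -(csum_reindex (p := q))//.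
  move=> [j Qj] [j' Qj'] /(congr1 (fun u => (sval (sval u)).2))/= jj.
  exact: eq_exist.
move=> [[[i' j] /= Qj] /= ii]; subst i'.
by exists (exist _ j Qj); do 2 apply: eq_exist.
Qed.

Lemma csum_pair (I J : Type) (m : I -> J -> S) :
  csum S (fun i => csum S (m i)) = csum S (fun t : I * J => m t.1 t.2).
Proof.
rewrite -(csum_partition fst); apply: eq_csum => i.
pose q (j : J) : {t : I * J | t.1 = i} := exist _ (i, j) erefl.
rewrite -(csum_reindex (p := q))// => [j j' [] //|[[i' j] /= ii]].
by subst i'; exists j; exact: eq_exist.
Qed.

Lemma csum_exchange (I J : Type) (m : I -> J -> S) :
  csum S (fun i => csum S (fun j => m i j)) =
  csum S (fun j => csum S (fun i => m i j)).
Proof.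
rewrite !csum_pair -(csum_reindex (p := fun t : J * I => (t.2, t.1)))//.
  by move=> [j i] [j' i'] [-> ->].
by move=> [i j]; exists (j, i).
Qed.

(** Change of variables along a map that is a bijection from [P] to [Q]. *)
Lemma csum_subtype_reindex (I J : Type) (P : I -> Prop) (Q : J -> Prop)
    (p : I -> J) (m : J -> S) :
  (forall i, P i -> Q (p i)) ->
  (forall i i', P i -> P i' -> p i = p i' -> i = i') ->
  (forall j, Q j -> exists2 i, P i & p i = j) ->
  csum S (fun i : {i | P i} => m (p (sval i))) =
  csum S (fun j : {j | Q j} => m (sval j)).
Proof.
move=> PQ pinj psurj.
pose q (i : {i | P i}) : {j | Q j} := exist _ (p (sval i)) (PQ _ (proj2_sig i)).
rewrite -(csum_reindex (p := q))//.
  by move=> [i Pi] [i' Pi'] /(congr1 sval)/= pp; apply: eq_exist; exact: pinj.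
move=> [j Qj]; have [i Pi pij] := psurj j Qj.
by exists (exist _ i Pi); exact: eq_exist.
Qed.

End Sums.

Section CompositionSemiring.
Variables (S : complete_semiring) (C : strict_monoidal_category).
Implicit Types a b c : Qmod S C.

Lemma eq_Qsum (I : Type) (a a' : I -> Qmod S C) :
  (forall i, a i = a' i) -> Qsum a = Qsum a'.
Proof. by move=> /funext ->. Qed.

Lemma Qsum_exchange (I J : Type) (a : I -> J -> Qmod S C) :
  Qsum (fun i => Qsum (fun j => a i j)) = Qsum (fun j => Qsum (fun i => a i j)).
Proof. by apply/funext => gamma; exact: csum_exchange. Qed.

Lemma Qmul_suml (I : Type) (a : I -> Qmod S C) b :
  Qmul (Qsum a) b = Qsum (fun i => Qmul (a i) b).
Proof.
apply/funext => gamma; rewrite /Qmul /Qsum csum_exchange.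
by apply: eq_csum => p; rewrite csumMl.
Qed.

Lemma Qmul_sumr (I : Type) a (b : I -> Qmod S C) :
  Qmul a (Qsum b) = Qsum (fun i => Qmul a (b i)).
Proof.
apply/funext => gamma; rewrite /Qmul /Qsum csum_exchange.
by apply: eq_csum => p; rewrite csumMr.
Qed.

Lemma Qmul_char (alpha beta : smor C) : scod alpha = sdom beta ->
  Qmul (Qchar S alpha) (Qchar S beta) = Qchar S (scomp beta alpha).
Proof.
move=> ab; apply/funext => gamma; rewrite /Qmul /Qchar.
case: asboolP => [->|ne].
  rewrite (@csum_single _ _ _ (exist _ (beta, alpha) (conj ab erefl)))/=.
    by rewrite !asboolT// mulr1.
  move=> [[x y] xy] ne /=; case: asboolP => [xb|_]; last by rewrite mul0r.
  case: asboolP => [ya|_]; last by rewrite mulr0.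
  by case: ne; apply: eq_exist; rewrite xb ya.
apply: csum_zero => -[[x y] [xy xyE]] /=.
case: asboolP => [xb|_]; last by rewrite mul0r.
case: asboolP => [ya|_]; last by rewrite mulr0.
by case: ne; rewrite -xyE /= xb ya.
Qed.

(** Both sides are sums over the factorizations of a morphism into three
factors. *)
Lemma QmulA a b c : Qmul a (Qmul b c) = Qmul (Qmul a b) c.
Proof.
apply/funext => gamma; rewrite /Qmul.
under eq_csum do rewrite -csumMr.
under [RHS]eq_csum do rewrite -csumMl.
pose P (p : smor C * smor C) := scod p.2 = sdom p.1 /\ scomp p.1 p.2 = gamma.
rewrite (@csum_subtype_nest _ _ _ P
  (fun p q => scod q.2 = sdom q.1 /\ scomp q.1 q.2 = p.1)
  (fun p q => c q.1 * b q.2 * a p.2)).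
rewrite (@csum_subtype_nest _ _ _ P
  (fun p q => scod q.2 = sdom q.1 /\ scomp q.1 q.2 = p.2)
  (fun p q => c p.1 * (b q.1 * a q.2))).
(* Rebrackets [((x o y, z), (x, y))] to [((x, y o z), (y, z))]. *)
pose f (t : (smor C * smor C) * (smor C * smor C)) :=
  ((t.2.1, scomp t.2.2 t.1.2), (t.2.2, t.1.2)).
apply: etrans (@csum_subtype_reindex S _ _
  (fun t => P t.1 /\ scod t.2.2 = sdom t.2.1 /\ scomp t.2.1 t.2.2 = t.1.1) _ f
  (fun t => c t.1.1 * (b t.2.1 * a t.2.2)) _ _ _); rewrite /P /f.
- by apply: eq_csum => t /=; rewrite mulrA.
- move=> [[xy z] [x y]] /= [[zxy xyzE] [yx xyE]]; subst xy gamma.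
  by rewrite sdom_comp// in zxy; rewrite scod_comp// scompA.
- move=> [[xy z] [x y]] [[xy' z'] [x' y']] /= [_ [_ <-]] [_ [_ <-]].
  by move=> [-> _ -> ->].
- move=> [[x yz] [y z]] /= [[yzx xyzE] [zy yzE]]; subst yz gamma.
  rewrite scod_comp// in yzx; exists ((scomp x y, z), (x, y)) => //=.
  by rewrite sdom_comp// scompA.
Qed.

(** The product distributes over infinite sums on both sides and these can be
exchanged. *)
Lemma contractionA (A1 A2 A3 A4 : Type) (z : A1 -> A2 -> Qmod S C)
    (z' : A2 -> A3 -> Qmod S C) (z'' : A3 -> A4 -> Qmod S C) :
  Defs.contraction z (Defs.contraction z' z'') =
  Defs.contraction (Defs.contraction z z') z''.
Proof.
apply/funext => f; apply/funext => h; rewrite /Defs.contraction.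
under eq_Qsum do rewrite Qmul_sumr.
rewrite Qsum_exchange; apply: eq_Qsum => g.
by rewrite Qmul_suml; apply: eq_Qsum => g'; rewrite QmulA.
Qed.

End CompositionSemiring.

Lemma eq_Qsum_pred (S : complete_semiring) (C : strict_monoidal_category)
    (I : Type) (P P' : I -> Prop) (a : I -> Qmod S C) :
  (forall i, P i <-> P' i) ->
  Qsum (fun i : {i | P i} => a (sval i)) =
  Qsum (fun i : {i | P' i} => a (sval i)).
Proof.
by move=> PP'; have -> : P = P' by apply/funext => i; exact/propext.
Qed.

(** * State sums under gluing and homeomorphism *)

Lemma subbordism_embedding (R : realType) (n : nat)
    (M0 N0 M N : closed_manifold R n) (W0 : bordism M0 N0) (W : bordism M N)
    (j : W0 -> W) : subbordism j -> embedding j.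
Proof. by case. Qed.

Section Fields.
Variables (R : realType) (n : nat) (F : field_system R n).
Implicit Types L M N P : closed_manifold R n.

Lemma eq_resB L M N (W : bordism M N) (j j' : L -> W) (hj : embedding j)
    (hj' : embedding j') (f : FW F W) : j = j' -> resB F hj f = resB F hj' f.
Proof. by move=> jj; subst j'; congr resB; exact: Prop_irrelevance. Qed.

Lemma resM_eq_id M (j : M -> M) (hj : embedding j) (f : F M) :
  j = id -> resM F hj f = f.
Proof. by move=> jid; subst j; exact: resM_id. Qed.

Lemma resW_eq_id M N (W : bordism M N) (j : W -> W) (hj : subbordism j)
    (f : FW F W) : j = id -> resW F hj f = f.
Proof. by move=> jid; subst j; exact: resW_id. Qed.

Lemma field_pairl M N (f : F M) (g : F N) : field_resl (field_pair f g) = f.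
Proof. by rewrite /field_pair; case: cid => h [[]]. Qed.

Lemma field_pairr M N (f : F M) (g : F N) : field_resr (field_pair f g) = g.
Proof. by rewrite /field_pair; case: cid => h [[]]. Qed.

Lemma field_union_eq M N (u u' : F (cm_union M N)) :
  field_resl u = field_resl u' -> field_resr u = field_resr u' -> u = u'.
Proof.
move=> ll rr; have [w [_ uniq_w]] := FM_disj F (field_resl u') (field_resr u').
by rewrite -(uniq_w u)// (uniq_w u').
Qed.

Lemma field_pair_res M N (u : F (cm_union M N)) :
  field_pair (field_resl u) (field_resr u) = u.
Proof.
by apply: field_union_eq; rewrite ?field_pairl ?field_pairr.
Qed.

Lemma boundary_fieldP M N (W : bordism M N) (G : FW F W) (f : F M) (g : F N) :
  resB F (boundary_embedding W) G = field_pair f g <->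
  resB F (bin_embedding W) G = f /\ resB F (bout_embedding W) G = g.
Proof.
have bl : field_resl (resB F (boundary_embedding W) G) =
    resB F (bin_embedding W) G.
  exact: (@resM_resB _ _ F M (cm_union M N) _ _ W dinl).
have br : field_resr (resB F (boundary_embedding W) G) =
    resB F (bout_embedding W) G.
  exact: (@resM_resB _ _ F N (cm_union M N) _ _ W dinr).
split=> [bG|[<- <-]].
  by rewrite -bl -br bG field_pairl field_pairr.
by rewrite -bl -br field_pair_res.
Qed.

(** Pull-back along the inverse homeomorphism is a left inverse. *)
Lemma resM_homeo_inj M M' (a : M -> M') (ha : embedding a) :
  homeomorphism a -> injective (@resM _ _ F M M' a ha).
Proof.
move=> [a' [_ ca' aK a'K]] f f' ff'.
have ea' : embedding a' by split; [exact: ca'|exact: can_inj a'K].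
have eaa' := embedding_comp ea' ha.
have id_aa' : a \o a' = id by apply/funext.
rewrite -(resM_eq_id eaa' f id_aa') -(resM_eq_id eaa' f' id_aa').
by rewrite -!(resM_comp ea' ha) ff'.
Qed.

Section StateSums.
Variables (S : complete_semiring) (C : strict_monoidal_category).
Variable T : action_exponentials F C.

Lemma state_sum_pairE M N (W : bordism M N) (f : F M) (g : F N) :
  on_pairs (state_sum S T W) f g =
  Qsum (fun G : {G : FW F W | resB F (bin_embedding W) G = f /\
                              resB F (bout_embedding W) G = g} =>
          Qchar S (TW T (sval G))).
Proof.
apply: (@eq_Qsum_pred S C _ _ _ (fun G => Qchar S (TW T G))) => G.
exact: boundary_fieldP.
Qed.

(** By (FGLUE), a field [G] on [W] amounts to a triple of a field [k] on the
common boundary and fields on the two pieces that restrict to [k]; by (TGLUE),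
its action is the composite of the actions of the pieces.  Expanding the product
of the two state sums gives the sum over these triples. *)
Lemma state_sum_glue M N P (W' : bordism M N) (W'' : bordism N P)
    (W : bordism M P) (j' : W' -> W) (j'' : W'' -> W) :
  is_gluing j' j'' ->
  on_pairs (state_sum S T W) =
  Defs.contraction (on_pairs (state_sum S T W')) (on_pairs (state_sum S T W'')).
Proof.
move=> h; apply/funext => f; apply/funext => g; rewrite /Defs.contraction.
have [_ _ Win Wout] := h.
pose res' := @resW _ _ F _ _ _ _ _ _ _ (gluingl_subbordism h).
pose res'' := @resW _ _ F _ _ _ _ _ _ _ (gluingr_subbordism h).
have in_res G : resB F (bin_embedding W') (res' G) = resB F (bin_embedding W) G.
  have e := embedding_comp (bin_embedding W')
    (subbordism_embedding (gluingl_subbordism h)).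
  by rewrite /res' (resB_resW _ _ e); exact: eq_resB.
have out_res G :
    resB F (bout_embedding W'') (res'' G) = resB F (bout_embedding W) G.
  have e := embedding_comp (bout_embedding W'')
    (subbordism_embedding (gluingr_subbordism h)).
  by rewrite /res'' (resB_resW _ _ e); exact: eq_resB.
pose in' := resB F (bin_embedding W'); pose out' := resB F (bout_embedding W').
pose in'' := resB F (bin_embedding W'').
pose out'' := resB F (bout_embedding W'').
(* The composability needed by [Qmul_char] comes from the glued field. *)
have -> : (fun k : F N => Qmul (on_pairs (state_sum S T W') f k)
      (on_pairs (state_sum S T W'') k g)) =
    fun k : F N => Qsum (fun G' : {G' | in' G' = f /\ out' G' = k} =>
      Qsum (fun G'' : {G'' | in'' G'' = k /\ out'' G'' = g} =>
      Qchar S (scomp (TW T (sval G'')) (TW T (sval G'))))).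
  apply/funext => k; rewrite !state_sum_pairE Qmul_suml.
  apply: eq_Qsum => -[G' [inG' outG']]; rewrite Qmul_sumr.
  apply: eq_Qsum => -[G'' [inG'' outG'']] /=.
  have glue_eq : resB F (bout_embedding W') G' = resB F (bin_embedding W'') G''.
    by rewrite (inG'' : _ = k).
  have [G [[<- <-] _]] := FW_glue h glue_eq.
  by rewrite Qmul_char//; have [] := TW_glue T h G.
rewrite state_sum_pairE; apply/funext => gamma; rewrite /Qsum.
have -> : (fun k : F N => csum S (fun G' : {G' | in' G' = f /\ out' G' = k} =>
      csum S (fun G'' : {G'' | in'' G'' = k /\ out'' G'' = g} =>
      Qchar S (scomp (TW T (sval G'')) (TW T (sval G'))) gamma))) =
    fun k : F N => csum S (fun t : {t : FW F W' * FW F W'' |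
        (in' t.1 = f /\ out' t.1 = k) /\ (in'' t.2 = k /\ out'' t.2 = g)} =>
      Qchar S (scomp (TW T (sval t).2) (TW T (sval t).1)) gamma).
  apply/funext => k.
  exact: (@csum_subtype_nest S _ _ (fun G' => in' G' = f /\ out' G' = k)
    (fun _ G'' => in'' G'' = k /\ out'' G'' = g)
    (fun G' G'' => Qchar S (scomp (TW T G'') (TW T G')) gamma)).
rewrite (@csum_nest S _ _ (fun k (t : FW F W' * FW F W'') =>
    (in' t.1 = f /\ out' t.1 = k) /\ (in'' t.2 = k /\ out'' t.2 = g))
  (fun k t => Qchar S (scomp (TW T t.2) (TW T t.1)) gamma)).
apply: etrans (@csum_subtype_reindex S _ _
  (fun G => resB F (bin_embedding W) G = f /\
            resB F (bout_embedding W) G = g) _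
  (fun G => (out' (res' G), (res' G, res'' G)))
  (fun t => Qchar S (scomp (TW T t.2.2) (TW T t.2.1)) gamma) _ _ _).
- by apply: eq_csum => -[G /= _]; have [_ ->] := TW_glue T h G.
- move=> G [inG outG] /=; rewrite /in' /out'' in_res out_res inG outG.
  by rewrite /out' /in'' (FW_glue_compat h).
- move=> G G1 _ _ [_ G'E G''E].
  have [G0 [_ uG0]] := FW_glue h (FW_glue_compat h G1).
  by rewrite -(uG0 G) ?(uG0 G1).
- move=> [k [G' G'']] /= [[inG' outG'] [inG'' outG'']].
  have [|G [[G'E G''E] _]] := FW_glue h (f' := G') (f'' := G'').
    exact: etrans outG' (esym inG'').
  exists G; last by rewrite /res' /res'' G'E G''E outG'.
  by rewrite -in_res -out_res /res' /res'' G'E G''E.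
Qed.

(** Pull-back along [phi] is an action-preserving bijection of fields that
transforms the boundary values by [a] and [b]. *)
Lemma state_sum_homeo M N M' N' (W : bordism M N) (W' : bordism M' N')
    (phi : W -> W') (a : M -> M') (b : N -> N') (ea : embedding a)
    (eb : embedding b) (f : F M') (g : F N') :
  homeomorphism phi -> homeomorphism a -> homeomorphism b ->
  phi \o bin W = bin W' \o a -> phi \o bout W = bout W' \o b ->
  on_pairs (state_sum S T W) (resM F ea f) (resM F eb g) =
  on_pairs (state_sum S T W') f g.
Proof.
move=> hphi ha hb phi_in phi_out.
have [psi [_ cpsi phiK psiK]] := hphi.
(* [phi] maps boundary onto boundary since [a] and [b] are surjective. *)
have img (A A' : closed_manifold R n) (k : A -> A') (i : A -> W)
    (i' : A' -> W') :
    homeomorphism k -> phi \o i = i' \o k -> phi @` range i = range i'.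
  move=> [k' [_ _ _ k'K]] E; apply/seteqP.
  split=> [_ [_ [z _ <-] <-]|_ [y _ <-]].
    by exists (k z) => //; exact: (esym (congr1 (@^~ z) E)).
  exists (i (k' y)); first by exists (k' y).
  by rewrite -[RHS](congr1 i' (k'K y)); exact: (congr1 (@^~ (k' y)) E).
have bphi : bordism_homeo phi by split=> //; [exact: img ha _|exact: img hb _].
have bpsi : bordism_homeo psi.
  have [_ iin iout] := bphi; split; first by exists phi; case: hphi => ? [].
    rewrite -iin; apply/seteqP; split=> [_ [_ [x ? <-] <-]|x rx].
      by rewrite phiK.
    by exists (phi x); [exists x|rewrite phiK].
  rewrite -iout; apply/seteqP; split=> [_ [_ [x ? <-] <-]|x rx].
    by rewrite phiK.
  by exists (phi x); [exists x|rewrite phiK].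
have sphi := bordism_homeo_subbordism bphi.
have spsi := bordism_homeo_subbordism bpsi.
have res_in G : resB F (bin_embedding W) (resW F sphi G) =
    resM F ea (resB F (bin_embedding W') G).
  have e1 := embedding_comp (bin_embedding W) (subbordism_embedding sphi).
  have e2 := embedding_comp ea (bin_embedding W').
  by rewrite (resB_resW _ _ e1) (resM_resB _ _ e2); exact: eq_resB.
have res_out G : resB F (bout_embedding W) (resW F sphi G) =
    resM F eb (resB F (bout_embedding W') G).
  have e1 := embedding_comp (bout_embedding W) (subbordism_embedding sphi).
  have e2 := embedding_comp eb (bout_embedding W').
  by rewrite (resB_resW _ _ e1) (resM_resB _ _ e2); exact: eq_resB.
have id_sub (A B : closed_manifold R n) (V : bordism A B) :
    @subbordism _ _ _ _ _ _ V V id.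
  apply: bordism_homeo_subbordism; split; rewrite ?image_id//.
  by exists id; split=> // x; exact: cvg_id.
have phipsi G : resW F spsi (resW F sphi G) = G.
  have E : phi \o psi = id by apply/funext => x; exact: psiK.
  have sE : @subbordism _ _ _ _ _ _ W' W' (phi \o psi).
    by rewrite E; exact: id_sub.
  by rewrite (resW_comp _ _ sE); exact: resW_eq_id.
have psiphi G : resW F sphi (resW F spsi G) = G.
  have E : psi \o phi = id by apply/funext => x; exact: phiK.
  have sE : @subbordism _ _ _ _ _ _ W W (psi \o phi).
    by rewrite E; exact: id_sub.
  by rewrite (resW_comp _ _ sE); exact: resW_eq_id.
rewrite !state_sum_pairE; apply/funext => gamma; apply/esym.
apply: etrans (@csum_subtype_reindex S _ _
  (fun G => resB F (bin_embedding W') G = f /\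
            resB F (bout_embedding W') G = g) _
  (@resW _ _ F _ _ _ _ _ _ _ sphi)
  (fun G => Qchar S (TW T G) gamma) _ _ _).
- apply: eq_csum => -[G /= _]; congr (Qchar S _ gamma).
  by rewrite -(TW_homeo T bphi); congr TW; congr resW; exact: Prop_irrelevance.
- by move=> G [<- <-]; rewrite res_in res_out.
- by move=> G G' _ _ E; rewrite -(phipsi G) E phipsi.
- move=> G [inG outG]; exists (resW F spsi G); last exact: psiphi.
  split; [apply: (resM_homeo_inj (ha := ea) ha)|
    apply: (resM_homeo_inj (ha := eb) hb)].
    by rewrite -res_in psiphi.
  by rewrite -res_out psiphi.
Qed.

End StateSums.
End Fields.

(** * Isotopies of disjoint unions *)

(** A continuous function with values in {0, 1} would otherwise attain 1/2. *)
Lemma unit_interval_two_values (R : realType) (k : unit_interval R -> R)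
    (t : unit_interval R) :
  continuous k -> (forall u, k u = 0 \/ k u = 1) -> k t = k (i0 R).
Proof.
move=> ck k01; pose A := (k \o @clamp R) @` [set` `[0, 1]].
have : connected A.
  apply: connected_continuous_connected; first exact: segment_connected.
  apply: continuous_subspaceT => s.
  exact: (continuous_comp (@clamp_continuous R s) (ck _)).
move=> /connected_intervalP iA.
have inA u : A (k u).
  exists (val u); last by rewrite /= clamp_val.
  by rewrite /= in_itv; exact: val_unit_interval.
have half (u v : unit_interval R) : k u = 0 -> k v = 1 -> False.
  move=> ku kv; have : A (1 / 2).
    apply: (iA (k u) (k v)); [exact: inA|exact: inA|].
    by rewrite ku kv; apply/andP; split; lra.
  by move=> [s _ /= ks]; case: (k01 (clamp s)) => E; move: ks; rewrite E; lra.
have [kt|kt] := k01 t; have [k0|k0] := k01 (i0 R); rewrite kt k0 //.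
- by have := half _ _ kt k0.
- by have := half _ _ k0 kt.
Qed.

(** [e : X -> Y] is the inclusion of a summand, cut out by a continuous function
[s] with values in {0, 1}. *)
Section IsotopyRestriction.
Variables (R : realType) (X Y : topologicalType) (e : X -> Y) (s : Y -> R).
Variable H : Y * unit_interval R -> Y.
Hypothesis hausX : hausdorff_space X.
Hypothesis compX : compact [set: X].
Hypothesis ce : continuous e.
Hypothesis ei : injective e.
Hypothesis oe : forall A, open A -> open (e @` A).
Hypothesis cs : continuous s.
Hypothesis s01 : forall y, s y = 0 \/ s y = 1.
Hypothesis sE : forall y, s y = 0 <-> exists x, y = e x.
Hypothesis cH : continuous H.
Hypothesis hH : forall t, homeomorphism (fun y => H (y, t)).
Hypothesis H0 : forall y, H (y, i0 R) = y.

Lemma isotopy_side y t : s (H (y, t)) = s y.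
Proof.
rewrite -[in RHS](H0 y).
apply: (@unit_interval_two_values R (fun t => s (H (y, t)))) => // u.
apply: (@continuous_comp _ _ _ (fun u => H (y, u)) s); last exact: cs.
apply: (@continuous_comp _ _ _ (fun u => (y, u)) H); last exact: cH.
apply: (@continuous_pair _ Y _ (fun=> y) id); first exact: cst_continuous.
exact: cvg_id.
Qed.

(** An isotopy from the identity cannot move points between summands, since each
point travels along a path; so it restricts to an isotopy of each summand. *)
Lemma isotopy_restrict : exists h : X * unit_interval R -> X,
  [/\ continuous h, forall x t, H (e x, t) = e (h (x, t)) &
      forall t, homeomorphism (fun x => h (x, t))].
Proof.
have se x : s (e x) = 0 by apply/sE; exists x.
have side p : exists x, H (e p.1, p.2) = e x by apply/sE; rewrite isotopy_side.
have [h hE] := choice side.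
have ch : continuous h.
  move=> p A; rewrite nbhsE => -[O [oO Ohp] OA].
  have ceH : {for p, continuous (fun p : X * unit_interval R => e (h p))}.
    have -> : (fun p => e (h p)) =
        fun p : X * unit_interval R => H (e p.1, p.2).
      by apply/funext => q; rewrite hE.
    apply: (@continuous_comp _ _ _
      (fun p : X * unit_interval R => (e p.1, p.2)) H).
      apply: (@continuous_pair _ _ _
        (fun p : X * unit_interval R => e p.1) snd).
        exact: (@continuous_fst_comp X _ Y e p (@ce p.1)).
      exact: cvg_snd.
    exact: cH.
  have nO : nbhs (e (h p)) (e @` O).
    by apply: open_nbhs_nbhs; split; [exact: oe|exists (h p)].
  have {}nO : nbhs p [set q | (e @` O) (e (h q))] := ceH _ nO.
  have : nbhs p (h @^-1` A); last by [].
  by apply: filterS nO => q [x Ox /ei xh]; apply: OA; rewrite -xh.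
exists h; split=> [//|x t|t]; first by rewrite -(hE (x, t)).
have [g [_ _ gK Kg]] := hH t.
apply: compact_hausdorff_homeo => //.
- move=> x.
  apply: (@continuous_comp _ _ _ (fun x : X => (x, t)) h); last exact: ch.
  by apply: continuous_pair; [exact: cvg_id|exact: cvg_cst].
- move=> x x' /(congr1 e); rewrite -(hE (x, t)) -(hE (x', t)).
  by move/(can_inj gK)/ei.
- move=> y; have : s (g (e y)) = 0.
    by rewrite -(isotopy_side _ t) (Kg (e y)).
  move=> /sE[x gx]; exists x; apply: ei; rewrite -(hE (x, t)) /= -gx.
  exact: Kg.
Qed.

End IsotopyRestriction.

Lemma dunion_prod_continuous (X Y Z V : topologicalType)
    (k : dunion X Y * V -> Z) :
  continuous (fun p : X * V => k (dinl p.1, p.2)) ->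
  continuous (fun p : Y * V => k (dinr p.1, p.2)) -> continuous k.
Proof.
move=> cl cr [u v]; elim/dunion_ind: u => [x|y] A nA.
  have [[P Q] /= [nP nQ] PQ] := cl (x, v) _ nA.
  exists (dinl @` P, Q) => /=; last first.
    by move=> [u w] /= [[x' Px' xu] Qw]; rewrite -xu; exact: (PQ (x', w)).
  by split=> //; exact: (@existT_nbhs _ (dunion_fam X Y) true).
have [[P Q] /= [nP nQ] PQ] := cr (y, v) _ nA.
exists (dinr @` P, Q) => /=; last first.
  by move=> [u w] /= [[y' Py' yu] Qw]; rewrite -yu; exact: (PQ (y', w)).
by split=> //; exact: (@existT_nbhs _ (dunion_fam X Y) false).
Qed.

Section UnionIsotopy.
Variables (R : realType) (n : nat).
Implicit Types M N : closed_manifold R n.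

Lemma isotopic_split M N (phi : cm_union M N -> cm_union M N) :
  isotopic_to_id R phi -> exists (a : M -> M) (b : N -> N),
  [/\ homeomorphism a, homeomorphism b, isotopic_to_id R a,
      isotopic_to_id R b & phi = dmap a b].
Proof.
move=> [H [cH hH H0 H1]].
have cc (r : R) (X : topologicalType) : continuous (fun _ : X => r).
  by move=> x; exact: cvg_cst.
have [hl [chl hlE hhl]] : exists h : M * unit_interval R -> M,
    [/\ continuous h, forall x t, H (dinl x, t) = dinl (h (x, t)) &
      forall t, homeomorphism (fun x => h (x, t))].
  apply: (@isotopy_restrict R M (dunion M N) dinl
    (dcase (fun=> 0) (fun=> 1)) H) => //.
  - exact: cm_hausdorff.
  - exact: cm_compact.
  - exact: dinl_continuous.
  - exact: dinl_inj.
  - exact: dinl_open.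
  - exact: (@dcase_continuous M N R).
  - by elim/dunion_ind => x; [left|right].
  - elim/dunion_ind => x /=; split=> //; first by exists x.
      by move/eqP; rewrite oner_eq0.
    by move=> [y /esym/dinl_dinr].
have [hr [chr hrE hhr]] : exists h : N * unit_interval R -> N,
    [/\ continuous h, forall x t, H (dinr x, t) = dinr (h (x, t)) &
      forall t, homeomorphism (fun x => h (x, t))].
  apply: (@isotopy_restrict R N (dunion M N) dinr
    (dcase (fun=> 1) (fun=> 0)) H) => //.
  - exact: cm_hausdorff.
  - exact: cm_compact.
  - exact: dinr_continuous.
  - exact: dinr_inj.
  - exact: dinr_open.
  - exact: (@dcase_continuous M N R).
  - by elim/dunion_ind => x; [right|left].
  - elim/dunion_ind => x /=; split=> //; last by exists x.
      by move/eqP; rewrite oner_eq0.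
    by move=> [y /dinl_dinr].
exists (fun x => hl (x, i1 R)), (fun y => hr (y, i1 R)); split=> //.
- exists hl; split=> // x; apply: (@dinl_inj M N).
  by rewrite -hlE H0.
- exists hr; split=> // x; apply: (@dinr_inj M N).
  by rewrite -hrE H0.
- by apply/funext; elim/dunion_ind => x; rewrite -H1 ?hlE ?hrE.
Qed.

Lemma dmap_homeomorphism M N (a : M -> M) (b : N -> N) :
  homeomorphism a -> homeomorphism b ->
  @homeomorphism (cm_union M N) (cm_union M N) (dmap a b).
Proof.
move=> [a' [ca ca' aK a'K]] [b' [cb cb' bK b'K]]; exists (dmap a' b').
have cm (f : M -> M) (g : N -> N) : continuous f -> continuous g ->
    continuous (dmap f g : cm_union M N -> cm_union M N).
  move=> cf cg; apply: dcase_continuous => x.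
    by apply: continuous_comp; [exact: cf|exact: dinl_continuous].
  by apply: continuous_comp; [exact: cg|exact: dinr_continuous].
split; [exact: cm|exact: cm| |].
- by elim/dunion_ind => x /=; rewrite /dmap /dcase /= ?aK ?bK.
- by elim/dunion_ind => x /=; rewrite /dmap /dcase /= ?a'K ?b'K.
Qed.

Lemma isotopic_dmap_id M N (b : N -> N) : isotopic_to_id R b ->
  @isotopic_to_id R (cm_union M N) (dmap id b).
Proof.
move=> [h [ch hh h0 h1]].
exists (fun p => dmap id (fun y => h (y, p.2)) p.1); split.
- apply: dunion_prod_continuous => /= p.
    apply: (@continuous_comp _ _ _ (fun p : M * unit_interval R => p.1)
      (@dinl M N)); [exact: cvg_fst|exact: dinl_continuous].
  have -> : (fun p : N * unit_interval R =>
      dmap (@id M) (fun y => h (y, p.2)) (@dinr M N p.1)) = @dinr M N \o h.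
    by apply/funext => -[].
  by apply: continuous_comp; [exact: ch|exact: dinr_continuous].
- move=> t; apply: (@dmap_homeomorphism M N id (fun y => h (y, t))) => //.
  by exists id; split=> // x; exact: cvg_id.
- by elim/dunion_ind => x //=; rewrite /dmap /dcase /= h0.
- by elim/dunion_ind => x //=; rewrite /dmap /dcase /= h1.
Qed.

(** The graph of an isotopy is a homeomorphism of the cylinder; its inverse is
continuous by compactness. *)
Lemma cylinder_sweep M (h : M * unit_interval R -> M) :
  continuous h -> (forall t, homeomorphism (fun x => h (x, t))) ->
  @homeomorphism (cylinder M) (cylinder M) (fun p => (h p, p.2)).
Proof.
move=> ch hh; apply: compact_hausdorff_homeo.
- exact: bd_compact.
- exact: bd_hausdorff.
- move=> p; apply: (@continuous_pair _ _ _ h snd); [exact: ch|exact: cvg_snd].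
- move=> [x t] [x' t'] /= [+ tt]; rewrite -tt.
  by have [g [_ _ gK _]] := hh t; move/(can_inj gK) ->.
- move=> [y t]; have [g [_ _ _ Kg]] := hh t.
  by exists (g y, t); rewrite /= (Kg y).
Qed.

End UnionIsotopy.

(** * The projection *)

Section Projection.
Variables (R : realType) (n : nat) (F : field_system R n).
Variables (S : complete_semiring) (C : strict_monoidal_category).
Variable T : action_exponentials F C.
Implicit Types M N : closed_manifold R n.

Let id_homeo (X : topologicalType) : @homeomorphism X X id.
Proof. by exists id; split=> // x; exact: cvg_id. Qed.

(** The isotopy is run backwards so that [a] acts at the incoming end. *)
Lemma cylinder_isotopyl M (a : M -> M) (ea : embedding a) (f h : F M) :
  homeomorphism a -> isotopic_to_id R a ->
  on_pairs (state_sum S T (cylinder M)) (resM F ea f) h =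
  on_pairs (state_sum S T (cylinder M)) f h.
Proof.
move=> ha [H [cH hH H0 H1]].
pose k (p : M * unit_interval R) := H (p.1, interval_flip p.2).
have eid : embedding (@id M) by exact: homeomorphism_embedding.
rewrite -{1}(resM_eq_id eid h erefl).
apply: (@state_sum_homeo _ _ F S C T M M M M (cylinder M) (cylinder M)
  (fun p => (k p, p.2)) a id ea eid f h) => //.
- apply: cylinder_sweep => [p|t]; last first.
    exact: (hH (interval_flip t)).
  apply: (@continuous_comp _ _ _
    (fun p : M * unit_interval R => (p.1, interval_flip p.2)) H);
    last exact: cH.
  apply: (@continuous_pair _ _ _ fst
    (fun p : M * unit_interval R => interval_flip p.2)); first exact: cvg_fst.
  by apply: continuous_snd_comp; exact: flip_continuous.
- by apply/funext => x; rewrite /= /cyl_in /k /= flip0 H1.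
- by apply/funext => x; rewrite /= /cyl_out /k /= flip1 H0.
Qed.

Lemma cylinder_isotopyr M (b : M -> M) (eb : embedding b) (f h : F M) :
  homeomorphism b -> isotopic_to_id R b ->
  on_pairs (state_sum S T (cylinder M)) f (resM F eb h) =
  on_pairs (state_sum S T (cylinder M)) f h.
Proof.
move=> hb [H [cH hH H0 H1]].
have eid : embedding (@id M) by exact: homeomorphism_embedding.
rewrite -{1}(resM_eq_id eid f erefl).
apply: (@state_sum_homeo _ _ F S C T M M M M (cylinder M) (cylinder M)
  (fun p => (H p, p.2)) id b eid eb f h) => //.
- exact: cylinder_sweep.
- by apply/funext => x; rewrite /= /cyl_in /= H0.
- by apply/funext => x; rewrite /= /cyl_out /= H1.
Qed.

Lemma on_unionK A M N (z : F M -> F N -> A) : on_pairs (on_union z) = z.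
Proof.
apply/funext => f; apply/funext => g.
by rewrite /on_pairs /on_union field_pairl field_pairr.
Qed.

Lemma on_pairsK A M N (z : F (cm_union M N) -> A) : on_union (on_pairs z) = z.
Proof. by apply/funext => u; rewrite /on_union /on_pairs field_pair_res. Qed.

Lemma field_res_dmap M N (a : M -> M) (b : N -> N) (ea : embedding a)
    (eb : embedding b)
    (e : @embedding (cm_union M N) (cm_union M N) (dmap a b)) u :
  field_resl (resM F e u) = resM F ea (field_resl u) /\
  field_resr (resM F e u) = resM F eb (field_resr u).
Proof.
pose U := cm_union M N; split.
  have e1 := embedding_comp ea (@dinl_embedding M N).
  exact: etrans (@resM_comp _ _ F M U U dinl (dmap a b) _ e e1 u)
    (esym (@resM_comp _ _ F M M U a dinl ea _ e1 u)).
have e1 := embedding_comp eb (@dinr_embedding M N).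
exact: etrans (@resM_comp _ _ F N U U dinr (dmap a b) _ e e1 u)
  (esym (@resM_comp _ _ F N N U b dinr eb _ e1 u)).
Qed.

(** Invariance can be tested on each summand separately, since every
homeomorphism of the disjoint union isotopic to the identity splits. *)
Lemma is_state_of_pairs M N (z : F M -> F N -> Qmod S C) :
  (forall (a : M -> M) (ea : embedding a) f g, homeomorphism a ->
     isotopic_to_id R a -> z (resM F ea f) g = z f g) ->
  (forall (b : N -> N) (eb : embedding b) f g, homeomorphism b ->
     isotopic_to_id R b -> z f (resM F eb g) = z f g) ->
  is_state (on_union z).
Proof.
move=> zl zr phi hphi iphi u.
have [a [b [ha hb ia ib E]]] := isotopic_split iphi; subst phi.
have ea := homeomorphism_embedding ha; have eb := homeomorphism_embedding hb.
rewrite /on_union.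
have [-> ->] := field_res_dmap ea eb (homeomorphism_embedding hphi) u.
by rewrite zl// zr.
Qed.

Lemma state_isotopyr M N (z : F (cm_union M N) -> Qmod S C) (b : N -> N)
    (eb : embedding b) f g :
  is_state z -> homeomorphism b -> isotopic_to_id R b ->
  on_pairs z f (resM F eb g) = on_pairs z f g.
Proof.
move=> sz hb ib; have hd := @dmap_homeomorphism R n M N id b (id_homeo M) hb.
rewrite /on_pairs -[RHS](sz _ hd (isotopic_dmap_id M ib)); congr z.
have eid : embedding (@id M) by exact: homeomorphism_embedding.
have [rl rr] := field_res_dmap eid eb (homeomorphism_embedding hd)
  (field_pair f g).
by apply: field_union_eq;
  rewrite ?rl ?rr !(field_pairl, field_pairr)// resM_eq_id.
Qed.

(** In the left variable the invariance is that of the state sum of the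
cylinder, in the right one that of [z]. *)
Lemma projection_is_state M N (z : F (cm_union M N) -> Qmod S C) :
  is_state z -> is_state (projection T z).
Proof.
move=> sz; apply: is_state_of_pairs.
- move=> a ea f g ha ia; apply: eq_Qsum => h; congr (Qmul _ _).
  exact: cylinder_isotopyl.
- move=> b eb f g hb ib; apply: eq_Qsum => h; congr (Qmul _ _).
  exact: state_isotopyr.
Qed.

Lemma projection_state_sum M N (W : bordism M N) :
  projection T (state_sum S T W) = state_sum S T W.
Proof.
have [j' [j'' glue]] := cylinder_gluing_in W.
by rewrite /projection -(state_sum_glue S T glue) on_pairsK.
Qed.

(** The state sum absorbs a cylinder on either side, and the cylinder takes care
of the invariance there. *)
Lemma state_sum_is_state M N (W : bordism M N) : is_state (state_sum S T W).
Proof.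
rewrite -[state_sum S T W]on_pairsK; apply: is_state_of_pairs.
- have [j' [j'' glue]] := cylinder_gluing_in W.
  move=> a ea f g ha ia; rewrite (state_sum_glue S T glue).
  by apply: eq_Qsum => h; congr (Qmul _ _); exact: cylinder_isotopyl.
- have [j' [j'' glue]] := cylinder_gluing_out W.
  move=> b eb f g hb ib; rewrite (state_sum_glue S T glue).
  by apply: eq_Qsum => h; congr (Qmul _ _); exact: cylinder_isotopyr.
Qed.

(** The cylinder on [M] is itself a bordism, so it absorbs another cylinder. *)
Lemma projection_idem M N (z : F (cm_union M N) -> Qmod S C) :
  projection T (projection T z) = projection T z.
Proof.
have [j' [j'' glue]] := cylinder_gluing_in (cylinder M).
by rewrite /projection on_unionK contractionA -(state_sum_glue S T glue).
Qed.

End Projection.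

Theorem proposition9p2 (R : realType) (n : nat) (S : complete_semiring)
    (C : strict_monoidal_category) (F : field_system R n)
    (T : action_exponentials F C) (M N : closed_manifold R n) :
  (forall z : F (cm_union M N) -> Qmod S C,
     is_state z -> is_state (projection T z)) /\
  (forall W : bordism M N,
     is_state (state_sum S T W) /\
     (exists2 z, is_state z & projection T z = state_sum S T W) /\
     projection T (state_sum S T W) = state_sum S T W) /\
  (forall z : F (cm_union M N) -> Qmod S C,
     is_state z -> projection T (projection T z) = projection T z).
Proof.
split; first exact: projection_is_state.
split=> [W|z _]; last exact: projection_idem.
split; first exact: state_sum_is_state.
split; last exact: projection_state_sum.
exists (state_sum S T W); first exact: state_sum_is_state.
exact: projection_state_sum.
Qed.
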